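(* Let $G$ be any (planar or non-planar) cubic graph with $E$ edges. Choose any ribbon structure on $G$ and any embedding of the resulting ribbon graph in $\mathbb{R}^3$, and let $R_G$ be its Yamada polynomial. Then $$F_G(0)\equiv 3^E\,R_G(1)^2 \pmod 5,$$ where $F_G$ is the flow polynomial of the abstract graph $G$.
   Context: Flow polynomial. For a finite graph $H$ (loops and multiple edges allowed), $F_H(Q)=\sum_{A\subseteq E(H)}(-1)^{|E(H)|-|A|}Q^{|A|-|V(H)|+c(A)}$, where $c(A)$ is the number of connected components of the spanning subgraph $(V(H),A)$. A vertex-free circle component is treated as one vertex with one loop (it contributes a factor $Q-1$). A cubic graph is one with all vertices of degree $3$. Ribbon graphs in $\mathbb{R}^3$. A ribbon graph is a graph $G$ with a $2$-dimensional thickening, encoded by a cyclic ordering of the half-edges at each vertex; a ribbon graph in $\mathbb{R}^3$ is such a thickened graph embedded in $\mathbb{R}^3$, up to isotopy. It is represented by a planar diagram: a generic immersion of $G$ in the plane, whose only singularities are transverse double points in the interiors of edges with over/under information, the ribbon being the planar (blackboard) thickening. Yamada polynomial. $R_G(q)\in\mathbb{Z}[q,q^{-1}]$ is computed from a planar diagram as follows. If the diagram has no crossings, i.e. it is a planar graph $H$, then $R_H(q)=(-1)^{|V(H)|-|E(H)|}F_H(q+2+q^{-1})$; this is equivalent to the contraction-deletion rule $R_H=R_{H/e}+R_{H\smallsetminus e}$ for non-loop edges $e$, together with the rule that adding a disjoint circle multiplies $R$ by $q+1+q^{-1}$, that $R_{G\vee H}=-R_GR_H$, and multiplicativity under disjoint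 union. In general, at each crossing, $R=q\,R_{0}+R_{\times}+q^{-1}R_{1}$, where the three diagrams differ from the original only near the crossing: ''$0$'' is the smoothing joining the two regions swept out when the over-strand is rotated counterclockwise until it meets the under-strand, ''$1$'' is the other planar smoothing, and ''$\times$'' replaces the crossing by a $4$-valent vertex. (The opposite convention for the two smoothings replaces $q$ by $q^{-1}$.) $R_G$ is an isotopy invariant of the ribbon graph $G$ in $\mathbb{R}^3$. For cubic $G$, the value $R_G(1)$ is, up to sign, the Penrose number of $G$. *)

(* Defs.v *)
From HB Require Import structures.
From mathcomp Require Import all_boot all_order all_algebra all_fingroup.

Set Implicit Arguments.
Unset Strict Implicit.
Unset Printing Implicit Defensive.

Import GRing.Theory.

Local Open Scope ring_scope.

(* Finite multigraphs, loops allowed; the two half-edges of e are (e, false)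
   and (e, true), so every edge carries an irrelevant orientation. *)
Record graph := Graph {
  vertex : finType;
  edge : finType;
  endpoint : edge -> bool -> vertex
}.

Definition half_edge (G : graph) : finType := (edge G * bool)%type.

Definition foot (G : graph) (h : half_edge G) : vertex G := endpoint h.1 h.2.

Definition degree (G : graph) (v : vertex G) : nat :=
  #|[set h : half_edge G | foot h == v]|.

Definition cubic (G : graph) : Prop := forall v : vertex G, degree v = 3%N.

(* For the flow polynomial only the set of ends of an edge matters: one vertex
   for a loop, two vertices otherwise. *)
Section FlowPolynomial.

Variables (V E : finType) (ends : E -> {set V}).

Definition adj_in (A : {set E}) : rel V :=
  fun u v => [exists e in A, (u \in ends e) && (v \in ends e)].

Definition num_comp (A : {set E}) : nat := n_comp (adj_in A) predT.

(* The exponent |A| - |V| + c(A) is the cycle rank of (V, A), so the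
   subtraction is never truncated. *)
Definition flow_polynomial : {poly int} :=
  \sum_(A : {set E}) (-1) ^+ (#|E| - #|A|) *: 'X^(#|A| + num_comp A - #|V|).

(* (-1)^(|V| - |E|) F(q + 2 + 1/q) *)
Definition planar_yamada (K : comUnitRingType) (q : K) : K :=
  (-1) ^+ (#|V| + #|E|) * (map_poly intr flow_polynomial).[q + 2%:R + q^-1].

End FlowPolynomial.

Definition flow (G : graph) : {poly int} :=
  flow_polynomial (fun e : edge G => [set endpoint e b | b : bool]).

Record ribbon (G : graph) := Ribbon {
  rot : {perm half_edge G};
  rot_cyclic : forall h h' : half_edge G,
    fconnect rot h h' = (foot h == foot h')
}.

(* The darts of a diagram with set of crossings X are the half-edges of G and
   four rays at each crossing, numbered counterclockwise by 'Z_4 so that rays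
   0 and 2 form the over-strand, and rays 1 and 3 the under-strand. *)
Definition dart (G : graph) (X : finType) : finType :=
  (half_edge G + X * 'Z_4)%type.

Section Darts.

Variables (G : graph) (X : finType).

Definition next_dart (S : ribbon G) (d : dart G X) : dart G X :=
  match d with
  | inl h => inl (rot S h)
  | inr (c, i) => inr (c, i + 1)
  end.

Definition across (d : dart G X) : dart G X :=
  match d with
  | inl h => inl h
  | inr (c, i) => inr (c, i + 2%:R)
  end.

Definition link (T : eqType) (f g : T -> T) : rel T :=
  fun x y => (f x == y) || (g x == y).

(* Euler's formula |V| - |E| + |F| = 2 c: every component of the combinatorial
   map (next_dart S, arc) has genus 0. *)
Definition planar_map (S : ribbon G) (arc : dart G X -> dart G X) : Prop :=
  (fcard (next_dart S) predT + fcard (next_dart S \o arc) predT =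
   fcard arc predT + 2 * n_comp (link (next_dart S) arc) predT)%N.

End Darts.

(* A planar diagram of a ribbon graph in R^3 with underlying ribbon graph
   (G, S), as a combinatorial map on the sphere: arc exchanges the two ends of
   each arc of the diagram.  Going straight through the crossings, the strand
   leaving one end of an edge of G arrives at its other end, and there is no
   strand besides those. *)
Record diagram (G : graph) (S : ribbon G) := Diagram {
  crossing : finType;
  arc : dart G crossing -> dart G crossing;
  arcK : involutive arc;
  arc_neq : forall d, arc d != d;
  arc_planar : planar_map S arc;
  strand_edge : forall e : edge G,
    connect (link arc (@across G crossing)) (inl (e, false)) (inl (e, true));
  strand_cover : forall d : dart G crossing,
    exists h : half_edge G, connect (link arc (@across G crossing)) (inl h) d
}.

Variant resolution := Smooth0 | Smooth1 | Vertex4.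

Definition ord_of_resolution (r : resolution) : 'I_3 :=
  match r with Smooth0 => inord 0 | Smooth1 => inord 1 | Vertex4 => inord 2 end.

Definition resolution_of_ord (i : 'I_3) : resolution :=
  match val i with 0 => Smooth0 | 1 => Smooth1 | _ => Vertex4 end.

Lemma ord_of_resolutionK : cancel ord_of_resolution resolution_of_ord.
Proof. by case; rewrite /resolution_of_ord /= inordK. Qed.

HB.instance Definition _ :=
  Finite.copy resolution (can_type ord_of_resolutionK).

(* Rotated counterclockwise, the over-strand sweeps the regions between rays 0
   and 1 and between rays 2 and 3.  Joining these two regions pairs ray 0 with
   ray 3 and ray 1 with ray 2. *)
Definition resolve (r : resolution) (i : 'Z_4) : 'Z_4 :=
  match r with
  | Smooth0 => - 1 - i
  | Smooth1 => 1 - i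
  | Vertex4 => i
  end.

Definition weight (K : comUnitRingType) (q : K) (r : resolution) : K :=
  match r with Smooth0 => q | Smooth1 => q^-1 | Vertex4 => 1 end.

Section State.

Variables (G : graph) (S : ribbon G) (D : diagram S).
Variable s : {ffun crossing D -> resolution}.

Notation dartD := (dart G (crossing D)).

Definition resolved (d : dartD) : dartD :=
  match d with
  | inl h => inl h
  | inr (c, i) => inr (c, resolve (s c) i)
  end.

(* After resolution, each edge or vertex-free circle is a class of darts. *)
Definition strands : {set {set dartD}} :=
  [set [set d' | connect (link (@arc G S D) resolved) d d'] | d : dartD].

Definition is_end (d : dartD) : bool :=
  match d with
  | inl _ => true
  | inr (c, _) => s c == Vertex4
  end.

Definition is_circle (B : {set dartD}) : bool :=
  (B \in strands) && [forall d in B, ~~ is_end d].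

Definition node : finType :=
  (vertex G + {c : crossing D | s c == Vertex4})%type.

Definition at_node (v : node) (d : dartD) : bool :=
  match v, d with
  | inl w, inl h => foot h == w
  | inr c, inr (c', _) => val c == c'
  | _, _ => false
  end.

(* A vertex-free circle is both an edge and the single vertex at its ends. *)
Definition state_vertex : finType :=
  (node + {B : {set dartD} | is_circle B})%type.

Definition state_edge : finType := {B : {set dartD} | B \in strands}.

Definition state_ends (B : state_edge) : {set state_vertex} :=
  [set v : state_vertex | match v with
     | inl w => [exists d in val B, at_node w d]
     | inr C => val C == val B
     end].

End State.

(* The Yamada polynomial, with all crossings expanded by
   R = q R_0 + R_x + q^-1 R_1.  A Laurent polynomial over int is given here by
   its values at the units q of commutative rings. *)
Definition yamada (G : graph) (S : ribbon G) (D : diagram S)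
    (K : comUnitRingType) (q : K) : K :=
  \sum_(s : {ffun crossing D -> resolution})
    (\prod_(c : crossing D) weight q (s c)) *
    planar_yamada (@state_ends G S D s) q.

(* Main.v *)
Require Import Defs.
From mathcomp Require Import all_boot all_order all_algebra all_fingroup.
From mathcomp Require Import zify ring.

(** Modulo 5, both sides of the congruence are sums over labellings of the
    half-edges of G by four labels, and the two sums are compared term by term.

    On the left, F_G(0) is congruent to F_G(5), the number N of nowhere-zero
    flows with values in the field with five elements (flow_polynomial_card).
    The condition of flow at a vertex, and the one relating the two halves of
    an edge, are functions of nonzero elements of that field, hence
    combinations of the monomials x ^ a for a modulo 4.  Expanding them makes N
    a sum over labellings by exponents, where an edge pairs a with - a
    (contraction_monomial).

    On the right, R_G(1) is the Penrose number P, the sum over all colourings of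
    the edges by 3 colours of the product of the signs of the cyclic orders of
    the colours at the vertices (yamada_penrose).  Indeed, at Q = 4 a planar
    state counts nowhere-zero flows with values in the Klein four-group
    (flow_polynomial_card2); the sum over the resolutions of the crossings only
    leaves the flows that go straight through all crossings, which are the edge
    colourings of G, with a sign -1 for each crossing of two distinct colours
    (yamada_straight).  As the projection is planar, such a flow comes from a
    colouring of the faces (face_potential).  Reading the face colours as the
    quaternions 1, i, j, k turns the signs of the crossings into signs of the
    vertices (klein_flow_sign).

    Let V be the space of dimension 3 spanned by the colours.  Then P ^ 2 is
    the value of a network on G with the square of the Levi-Civita tensor at
    the vertices and the identity of V (x) V on the edges.  The sum of this
    identity with the two other pairings of four copies of V, the exchange of
    the factors and the contraction, is negligible modulo 5 (negligible).
    Hence the identity can be replaced by one half of its difference with the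
    two others, the projector onto a summand of dimension 4, the sum of the
    scalars and of so(3).  In a suitable basis of this summand, in which 2
    plays the role of a square root of -1, the edge tensor is the pairing of
    exponents above, and the vertex tensor is 3 times the one of the monomials
    up to entries that do not contribute for reasons of weight
    (so3_monomial_sum, contraction_weight).  This proves 2 ^ E P ^ 2 = 3 ^ V N
    (contraction_comparison), and the theorem follows from 3 V = 2 E. *)

Set Implicit Arguments.
Unset Strict Implicit.
Unset Printing Implicit Defensive.

Import Order.TTheory GRing.Theory Num.Theory.

Local Open Scope ring_scope.

(** * Flows over a finite field and values of the flow polynomial *)

Lemma card_bij_on (A B : finType) (P : pred A) (Q : pred B)
    (f : A -> B) (g : B -> A) :
    (forall a, P a -> Q (f a) /\ g (f a) = a) ->
    (forall b, Q b -> P (g b) /\ f (g b) = b) ->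
  #|[set a | P a]| = #|[set b | Q b]|.
Proof.
move=> fP gQ.
have injf : {in [set a | P a] &, injective f}.
  move=> a a'; rewrite !inE => /fP[_ fK] /fP[_ fK'] eqf.
  by rewrite -fK eqf fK'.
rewrite -(card_in_imset injf); apply: eq_card => b; rewrite !inE.
apply/imsetP/idP => [[a] | Qb]; first by rewrite inE => /fP[Qfa _] ->.
by have [Pg fg] := gQ b Qb; exists (g b); rewrite ?inE.
Qed.

Lemma prod_bool (R : comPzRingType) (I : finType) (P : pred I) :
  \prod_i (P i)%:R = [forall i, P i]%:R :> R.
Proof.
case: (boolP [forall i, P i]) => [/forallP PP | ].
  by apply: big1 => i _; rewrite PP.
rewrite negb_forall => /existsP[i /negbTE Pi].
by rewrite (bigD1 i) //= Pi mul0r.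
Qed.

Lemma card_locally_constant (T K : finType) (e : rel T) : connect_sym e ->
  #|[set u : {ffun T -> K} | [forall x, forall y, e x y ==> (u x == u y)]]|
    = (#|K| ^ n_comp e predT)%N.
Proof.
move=> symE; pose rt : finType := {x : T | roots e x}.
pose rt_of x : rt := exist _ (fingraph.root e x) (roots_root symE x).
have cst (u : {ffun T -> K}) x y :
  [forall x, forall y, e x y ==> (u x == u y)] -> connect e x y -> u x = u y.
  move=> uP /connectP[p + ->]; elim: p x => //= z p IH x /andP[exz /IH <-].
  by have /forallP/(_ z)/implyP/(_ exz)/eqP := forallP uP x.
rewrite (@card_bij_on _ {ffun rt -> K} _ predT
  (fun u : {ffun T -> K} => [ffun r => u (val r)])
  (fun w : {ffun rt -> K} => [ffun x => w (rt_of x)])) //.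
- rewrite cardsT card_ffun card_sig; congr (_ ^ _)%N.
  by apply: eq_card => x; rewrite !inE andbT.
- move=> u uP; split=> //; apply/ffunP=> x; rewrite !ffunE /=.
  by apply/esym/(cst _ _ _ uP)/connect_root.
move=> w _; split.
  apply/'forall_forallP => x y; apply/implyP => exy; rewrite !ffunE.
  apply/eqP; congr (w _); apply: val_inj => /=.
  by apply/eqP; rewrite (root_connect symE) connect1.
apply/ffunP=> r; rewrite !ffunE; congr (w _); apply: val_inj => /=.
by apply/eqP; case: r.
Qed.

Section Counting.

Variable F : finFieldType.

Lemma card_rowspace m n (A : 'M[F]_(m, n)) :
  #|[set u : 'rV_n | (u <= A)%MS]| = (#|F| ^ \rank A)%N.
Proof.
have freeA := row_base_free A.
rewrite (@card_bij_on _ 'rV[F]_(\rank A) _ predT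
  (fun u => u *m pinvmx (row_base A)) (fun w => w *m row_base A)) //.
- by rewrite cardsT card_mx mul1n.
- by move=> u uA; rewrite mulmxKpV ?eq_row_base.
by move=> w _; rewrite -(eq_row_base A) submxMl -mulmxA mulmxVp // mulmx1.
Qed.

Variables T U : finType.

(* Functions on finite types are encoded as row vectors, to use ranks. *)
Definition row_of (u : T -> F) : 'rV[F]_#|T| := \row_i u (enum_val i).
Definition fun_of (w : 'rV[F]_#|T|) : {ffun T -> F} :=
  [ffun x => w 0 (enum_rank x)].
Definition kernel_mx (k : T -> U -> F) : 'M[F]_(#|T|, #|U|) :=
  \matrix_(i, j) k (enum_val i) (enum_val j).

Lemma row_ofE (u : T -> F) x : fun_of (row_of u) x = u x.
Proof. by rewrite ffunE mxE enum_rankK. Qed.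

Lemma row_ofK (u : {ffun T -> F}) : fun_of (row_of u) = u.
Proof. by apply/ffunP=> x; rewrite row_ofE. Qed.

Lemma fun_ofK w : row_of (fun_of w) = w.
Proof. by apply/rowP=> i; rewrite mxE ffunE enum_valK. Qed.

Lemma sum_enum_val (G : T -> F) : \sum_(i < #|T|) G (enum_val i) = \sum_x G x.
Proof. by rewrite -(big_enum_val (A := predT) G); apply: eq_bigl. Qed.

Lemma row_of_mul u k j :
  (row_of u *m kernel_mx k) 0 j = \sum_x u x * k x (enum_val j).
Proof.
by rewrite mxE -[RHS]sum_enum_val; apply: eq_bigr => i _; rewrite !mxE.
Qed.

Lemma row_of_ker u k :
  (row_of u *m kernel_mx k == 0) = [forall y, \sum_x u x * k x y == 0].
Proof.
apply/eqP/forallP => [u0 y | u0].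
  by rewrite -(enum_rankK y) -row_of_mul u0 mxE.
by apply/rowP => j; rewrite row_of_mul mxE; apply/eqP.
Qed.

Lemma card_fun_rowspace m (A : 'M[F]_(m, #|T|)) (P : pred {ffun T -> F}) :
    (forall u, P u = (row_of u <= A)%MS) ->
  #|[set u | P u]| = (#|F| ^ \rank A)%N.
Proof.
move=> PA; rewrite -card_rowspace.
apply: (@card_bij_on _ _ P (fun w => (w <= A)%MS)
  (fun u : {ffun T -> F} => row_of u) (@fun_of)) => [u | w].
  by rewrite PA row_ofK.
by rewrite PA fun_ofK.
Qed.

End Counting.

Section Flows.

Variables (F : finFieldType) (V E : finType) (t h : E -> V) (A : {set E}).

Definition incidence (e : E) (v : V) : F := (h e == v)%:R - (t e == v)%:R.

Definition is_flow (x : E -> F) : bool :=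
  [forall v, \sum_e x e * incidence e v == 0].

Lemma sum_indicator (R : pzRingType) (I : finType) (u : I -> R) a :
  \sum_v u v * (a == v)%:R = u a.
Proof.
rewrite (bigD1 a) //= eqxx mulr1 big1 ?addr0 // => v neq.
by rewrite eq_sym (negbTE neq) mulr0.
Qed.

Variable ends : E -> {set V}.
Hypothesis endsE : forall e, ends e = [set t e; h e].

Lemma adj_in_sym : connect_sym (adj_in ends A).
Proof.
apply: sym_connect_sym => u v; apply: eq_existsb => e.
by rewrite [(u \in _) && _]andbC.
Qed.
End Flows.

(** The transpose of the incidence matrix annihilates exactly the functions of
    vertices that are constant on components. *)
Lemma rank_incidence (F : finFieldType) (V E : finType) (t h : E -> V)
    (e : rel V) :
    connect_sym e ->
    (forall (u : V -> F), (forall x y, e x y -> u x = u y) <->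
       (forall a, u (t a) = u (h a))) ->
  #|V| = (\rank (kernel_mx (incidence F t h)) + n_comp e predT)%N.
Proof.
move=> symE eP; set M := kernel_mx _.
have := card_locally_constant F symE.
rewrite (@card_fun_rowspace _ _ _ (kermx M^T)) => [|u].
  move/eqP; rewrite eqn_exp2l; last exact: card_finNzRing_gt1.
  rewrite mxrank_ker mxrank_tr => /eqP <-.
  by rewrite subnKC // rank_leq_col.
rewrite sub_kermx.
have -> : M^T = kernel_mx (fun v a => incidence F t h a v).
  by apply/matrixP=> i j; rewrite !mxE.
rewrite row_of_ker; apply/'forall_forallP/forallP => [uP a | uP].
  have uth : u (t a) = u (h a).
    have [+ _] := eP u; apply=> x y exy.
    by apply/eqP; have := uP x y; rewrite exy.
  under eq_bigr => v _ do rewrite mulrBr.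
  by rewrite sumrB !sum_indicator uth subrr.
have [_ /(_ _) eu] := eP u.
move=> x y; apply/implyP => exy; apply/eqP/eu => // a.
apply/eqP; rewrite eq_sym -subr_eq0 -!(sum_indicator u) -sumrB.
by have := uP a; under eq_bigr => v _ do rewrite mulrBr.
Qed.

(** The dimension of the space of flows on A is the corank of the incidence
    matrix of A, that is, the cycle rank of A by rank_incidence. *)
Lemma card_flows (F : finFieldType) (V E : finType) (t h : E -> V)
    (ends : E -> {set V}) (A : {set E}) :
    (forall e, ends e = [set t e; h e]) ->
  #|[set x : {ffun E -> F} |
      is_flow t h x && ([set e | x e != 0] \subset A)]|
    = (#|F| ^ (#|A| + num_comp ends A - #|V|))%N.
Proof.
move=> endsE; pose EA : finType := {e | e \in A}.
pose tA (a : EA) := t (val a); pose hA (a : EA) := h (val a).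
have rkV : #|V| = (\rank (kernel_mx (incidence F tA hA)) + num_comp ends A)%N.
  apply: rank_incidence => [|u]; first exact: adj_in_sym.
  split=> [uP [a aA] | uP x y /existsP[a /and3P[aA]]].
    apply: uP; apply/existsP; exists a; rewrite aA endsE /= !inE !eqxx.
    by rewrite orbT.
  have := uP (exist _ a aA); rewrite /tA /hA /= => uth.
  by rewrite endsE !inE => /orP[]/eqP-> /orP[]/eqP->.
rewrite {1}rkV subnDr.
have supp (x : {ffun E -> F}) :
    [set e | x e != 0] \subset A -> forall e, e \notin A -> x e = 0.
  move=> /subsetP xA e; apply: contraNeq => xe; apply: xA.
  by rewrite inE.
rewrite (@card_bij_on _ {ffun EA -> F} _ (fun y => is_flow tA hA y)
  (fun x : {ffun E -> F} => [ffun a : EA => x (val a)])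
  (fun y : {ffun EA -> F} => [ffun e => oapp y 0 (insub e)])).
- rewrite (@card_fun_rowspace _ _ _ (kermx (kernel_mx (incidence F tA hA)))).
    by rewrite mxrank_ker; congr (_ ^ (_ - _))%N; rewrite card_sig.
  by move=> u; rewrite sub_kermx row_of_ker.
- move=> x /andP[/forallP fx /supp sx]; split.
    apply/forallP => v; apply/eqP; rewrite -[RHS](eqP (fx v)); apply/esym.
    rewrite (bigID [in A]) /= [X in _ + X]big1 ?addr0 => [|e eA].
      by rewrite big_sub; apply: eq_bigr => a _; rewrite ffunE.
    by rewrite sx // mul0r.
  apply/ffunP=> e; rewrite !ffunE; case: insubP => [a _ <- /=|/sx->] //.
  by rewrite ffunE.
move=> y /forallP fy; split.
  apply/andP; split.
    apply/forallP => v; apply/eqP; rewrite -[RHS](eqP (fy v)).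
    rewrite (bigID [in A]) /= [X in _ + X]big1 ?addr0 => [|e eA].
      by rewrite big_sub; apply: eq_bigr => a _; rewrite ffunE valK.
    by rewrite ffunE insubN // mul0r.
  apply/subsetP => e; rewrite inE ffunE; case: insubP => [a aA <- // | _] /=.
    by move=> _; apply: (valP a).
  by rewrite eqxx.
by apply/ffunP=> a; rewrite !ffunE valK.
Qed.

(** The sum is the expansion of the product of 1 - [e not in B] over all e. *)
Lemma sum_signed_supersets (E : finType) (B : {set E}) :
  \sum_(A : {set E} | B \subset A) (-1) ^+ (#|E| - #|A|) = (B == setT)%:R :> int.
Proof.
transitivity (\prod_(e : E) (1 + (- (e \notin B)%:R)) : int).
  rewrite bigA_distr /= [LHS]big_mkcond.
  apply: eq_bigr => A _; rewrite (bigID [in A]) /= [X in _ = X * _]big1 ?mul1r.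
    rewrite (eq_bigr (fun e => - (e \notin B)%:R)); last first.
      by move=> e /negbTE ->.
    case: ifPn => [/subsetP BA | /subsetPn[e eB eA]].
      rewrite (eq_bigr (fun=> -1)) => [|e eA].
        rewrite prodr_const; congr (_ ^+ _).
        by rewrite -(cardC (mem A)) addKn; apply: eq_card.
      by rewrite (contraNN (BA e) eA).
    by rewrite (bigD1 e) //= eB oppr0 mul0r.
  by move=> e ->.
case: eqP => [-> | /eqP]; first by apply: big1 => e _; rewrite inE oppr0 addr0.
rewrite -subTset => /subsetPn[e _ eB].
by rewrite (bigD1 e) //= eB subrr mul0r.
Qed.

Lemma inclusion_exclusion (X E : finType) (P : pred X) (supp : X -> {set E}) :
  #|[set x | P x && (supp x == setT)]|%:R =
  \sum_(A : {set E}) (-1) ^+ (#|E| - #|A|)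
     * #|[set x | P x && (supp x \subset A)]|%:R :> int.
Proof.
under eq_bigr => A _.
  rewrite -[#|[set x | _]|]sum1_card natr_sum big_distrr /= big_mkcond; over.
rewrite exchange_big -sum1_card natr_sum big_mkcond; apply: eq_bigr => x _ /=.
rewrite inE; case Px: (P x) => /=; last first.
  by rewrite big1 // => A _; rewrite inE Px.
transitivity ((supp x == setT)%:R : int); first by case: ifP.
rewrite -sum_signed_supersets [LHS]big_mkcond; apply: eq_bigr => A _.
by rewrite inE Px mulr1.
Qed.

Section FlowPolynomialValues.

Variables (F : finFieldType) (V E : finType) (t h : E -> V).
Variable ends : E -> {set V}.
Hypothesis endsE : forall e, ends e = [set t e; h e].

(** Inclusion and exclusion on the support of a flow, each term being given by
    card_flows. *)
Lemma flow_polynomial_card :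
  (flow_polynomial ends).[#|F|%:R] =
  #|[set x : {ffun E -> F} | is_flow t h x && [forall e, x e != 0]]|%:R.
Proof.
pose supp (x : {ffun E -> F}) := [set e | x e != 0].
transitivity (#|[set x : {ffun E -> F} | is_flow t h x && (supp x == setT)]|%:R : int).
  rewrite inclusion_exclusion /flow_polynomial horner_sum.
  apply: eq_bigr => A _.
  by rewrite hornerZ hornerXn (card_flows F A endsE) natrX.
congr (_%:R); apply: eq_card => x; rewrite !inE; congr (_ && _).
by apply/eqP/forallP => [sx e | sx]; first have := in_setT e;
  rewrite -?sx ?inE //; apply/setP => e; rewrite !inE sx.
Qed.

(** A pair of flows is a flow with values in F ^ 2, a group of order #|F| ^ 2. *)
Lemma flow_polynomial_card2 :
  (flow_polynomial ends).[(#|F| ^ 2)%:R] =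
  #|[set z : {ffun E -> F} * {ffun E -> F} | is_flow t h z.1 && is_flow t h z.2
      && [forall e, (z.1 e != 0) || (z.2 e != 0)]]|%:R.
Proof.
pose supp (x : {ffun E -> F}) := [set e | x e != 0].
pose fl (z : {ffun E -> F} * {ffun E -> F}) := is_flow t h z.1 && is_flow t h z.2.
transitivity (#|[set z | fl z && (supp z.1 :|: supp z.2 == setT)]|%:R : int).
  rewrite (@inclusion_exclusion _ _ fl) /flow_polynomial horner_sum.
  apply: eq_bigr => A _; rewrite hornerZ hornerXn; congr (_ * _).
  pose W := [set x : {ffun E -> F} | is_flow t h x && (supp x \subset A)].
  transitivity (#|setX W W|%:R : int).
    by rewrite cardsX (card_flows F A endsE) -natrX -expnM mulnC expnM.
  congr (_%:R); apply: eq_card => z; rewrite !inE subUset /fl.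
  by rewrite andbACA.
congr (_%:R); apply: eq_card => x; rewrite !inE; congr (_ && _).
by apply/eqP/forallP => [sx e | sx]; first have := in_setT e;
  rewrite -?sx ?inE //; apply/setP => e; rewrite !inE sx.
Qed.

End FlowPolynomialValues.

(** * Components of a pair of involutions *)

Lemma link_sym (T : finType) (a r : T -> T) :
  involutive a -> involutive r -> connect_sym (link a r).
Proof.
move=> aK rK; apply: sym_connect_sym => x y; rewrite /link.
by rewrite -(inj_eq (can_inj aK)) aK -(inj_eq (can_inj rK) (r x)) rK
  ![x == _]eq_sym.
Qed.

Lemma connect_link_invariant (T : finType) (K : Type) (a r : T -> T) (y : T -> K) :
    (forall x, y (a x) = y x) -> (forall x, y (r x) = y x) ->
  forall u v, connect (link a r) u v -> y u = y v.
Proof.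
move=> ya yr u v /connectP[p + ->]; elim: p u => //= w p IH u.
by case/andP=> /orP[]/eqP <- /IH <-.
Qed.

Section Ends.

Variables (T : finType) (a r : T -> T).
Hypotheses (aK : involutive a) (rK : involutive r) (a_neq : forall x, a x != x).

Let p x := r (a x).

Let p_inj : injective p.
Proof. exact: inj_comp (can_inj rK) (can_inj aK). Qed.

Variable d : T.
Hypothesis rd : r d = d.

Let iter_a k : iter k.+1 p (a (iter k p d)) = d.
Proof.
elim: k => [|k IH]; first by rewrite /= /p aK.
by rewrite iterSr [X in iter _ p X](_ : _ = a (iter k p d)) // /p aK rK.
Qed.

Let iter_r k : iter k p (r (iter k p d)) = d.
Proof.
elim: k => [|k IH] //.
by rewrite iterSr [X in iter _ p X](_ : _ = r (iter k p d)) //= /p !(aK, rK).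
Qed.

Let n := fingraph.order p d.

Let iter_n : iter n p d = d.
Proof. exact: iter_order. Qed.

Let iter_small k : (k < n)%N -> iter k p d = d -> k = 0%N.
Proof. by move=> kn kd; rewrite -(findex_iter kn) kd findex0. Qed.

Let iter_injk k x y : iter k p x = iter k p y -> x = y.
Proof. by elim: k => //= k IH /p_inj/IH. Qed.

(** A component of two involutions, the first without fixed points, is a path
    or a cycle.  The composite p of the involutions turns it into a cycle of
    length n, on which they act as the reflections k -> -k and k -> -k-1.  The
    latter has no fixed point, hence n is even and the former fixes exactly
    0 and n/2. *)
Lemma other_end : exists2 d', [/\ d' != d, r d' = d' & connect (link a r) d d'] &
  forall x, connect (link a r) d x -> r x = x -> x = d \/ x = d'.
Proof.
have n_even : odd n = false.
  apply/negP => n_odd; have /negP[] := a_neq (iter n./2 p d).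
  apply/eqP/(@iter_injk n./2.+1); rewrite iter_a -iterD.
  by rewrite -[LHS]iter_n -{1}(odd_double_half n) n_odd -addnn.
have n_gt0 : (0 < n)%N := fingraph.order_gt0 p d.
have nE : (n = n./2 + n./2)%N by rewrite addnn -[LHS]odd_double_half n_even.
have conn k : connect (link a r) d (iter k p d).
  elim: k => [|k IH] //=; apply: (connect_trans IH).
  apply: (@connect_trans _ _ (a (iter k p d))); apply: connect1.
    by rewrite /link eqxx.
  by rewrite /link eqxx orbT.
exists (iter n./2 p d).
  split=> //.
    apply/eqP => /iter_small; lia.
  by apply: (@iter_injk n./2); rewrite iter_r -iterD -nE iter_n.
move=> x dx rx.
have {dx} dx : fconnect p d x.
  have step y z : link a r y z -> fconnect p d y -> fconnect p d z.
    move=> yz /iter_findex yE; rewrite fconnect_sym //; move: yE yz.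
    set k := findex p d y => <- /orP[] /eqP <-.
      by have := fconnect_iter p k.+1 (a (iter k p d)); rewrite iter_a.
    by have := fconnect_iter p k (r (iter k p d)); rewrite iter_r.
  case/connectP: dx (connect0 (frel p) d) => q + ->.
  by elim: q {1 3 5}d => //= y q IH z /andP[zy /IH{}IH] /(step _ _ zy).
have kn := findex_max dx; have xE := iter_findex dx.
set k := findex p d x in kn xE.
have k2 : iter (k + k) p d = d.
  by rewrite iterD xE; have := iter_r k; rewrite xE rx.
have [/iter_small/(_ k2) k0 | n_le] := ltnP (k + k) n.
  by left; rewrite -xE (_ : k = 0%N) //; lia.
right; rewrite -xE; congr (iter _ p d).
have /iter_small k20 : (k + k - n < n)%N by lia.
have : iter (k + k - n) p d = d.
  by rewrite -[d in LHS]iter_n -iterD subnK.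
by move/k20; lia.
Qed.

End Ends.

(** * Potentials of flows on planar maps *)

Section Planarity.

Variable T : finType.

Implicit Types (f g : T -> T).

(* the operator u |-> u \o f - u on functions with values in the field bool *)
Definition shift_mx f : 'M[bool]_#|T| :=
  kernel_mx (fun x y => (x == f y)%:R - (x == y)%:R : bool).

Definition invariants f := kermx (shift_mx f).

Lemma row_of_shift f (u : T -> bool) :
  row_of u *m shift_mx f = row_of (fun x => u (f x) - u x).
Proof.
apply/rowP => j; rewrite row_of_mul mxE; set y := enum_val j.
under eq_bigr => x _ do rewrite mulrBr ![x == _]eq_sym.
by rewrite sumrB !sum_indicator.
Qed.

Lemma row_of_invariants f (u : T -> bool) :
  (row_of u <= invariants f)%MS = [forall x, u (f x) == u x].
Proof.
rewrite sub_kermx row_of_shift; apply/eqP/forallP => [u0 x | uf].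
  by have /rowP/(_ (enum_rank x)) := u0; rewrite !mxE enum_rankK -subr_eq0 => ->.
by apply/rowP => i; rewrite !mxE (eqP (uf _)) subrr.
Qed.

Lemma rank_invariants f : injective f -> \rank (invariants f) = fcard f predT.
Proof.
move=> injf; have := card_locally_constant bool (fconnect_sym injf).
rewrite (@card_fun_rowspace _ _ _ (invariants f)) => [/eqP | u].
  by rewrite !card_bool eqn_exp2l // => /eqP.
rewrite row_of_invariants; apply/'forall_forallP/forallP => uf x.
  by have := uf x (f x); rewrite /= eqxx eq_sym.
by move=> y; apply/implyP => /eqP <-; rewrite eq_sym.
Qed.

Lemma rank_invariants_cap f g (P : pred {ffun T -> bool}) m :
    (forall u, P u = [forall x, (u (f x) == u x) && (u (g x) == u x)]) ->
    #|[set u | P u]| = (2 ^ m)%N ->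
  \rank (invariants f :&: invariants g)%MS = m.
Proof.
move=> PE; rewrite (@card_fun_rowspace _ _ _ (invariants f :&: invariants g)%MS).
  by move/eqP; rewrite !card_bool eqn_exp2l // => /eqP.
move=> u; rewrite PE sub_capmx !row_of_invariants.
apply/forallP/andP => [ufg | [/forallP uf /forallP ug] x].
  by split; apply/forallP => x; case/andP: (ufg x).
by rewrite uf ug.
Qed.

Lemma row_of_mul_tr m (K : 'M[bool]_(m, #|T|)) (y : T -> bool) :
  (forall j, \sum_z y z * fun_of (row j K) z = 0) -> row_of y *m K^T = 0.
Proof.
move=> yK; apply/rowP => j; rewrite mxE mxE -[RHS](yK j) -[RHS]sum_enum_val.
by apply: eq_bigr => k _; rewrite !mxE ffunE enum_valK mxE.
Qed.

Variables (next arc : T -> T).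
Hypotheses (next_inj : injective next) (arcK : involutive arc).
Hypothesis arc_neq : forall x, arc x != x.

Let arc_inj : injective arc := can_inj arcK.

Lemma card_darts : #|T| = (2 * fcard arc predT)%N.
Proof.
rewrite mulnC (@fcard_order_set _ arc arc_inj 2) //.
apply/subsetP => x _; rewrite inE.
rewrite (@order_cycle _ _ [:: x; arc x]) //= ?inE ?eqxx ?arcK ?eqxx //.
by rewrite eq_sym arc_neq.
Qed.

Lemma tr_shift_arc : (shift_mx arc)^T = shift_mx arc.
Proof.
apply/matrixP=> i j; rewrite !mxE [enum_val j == _]eq_sym.
by rewrite [enum_val j == _]eq_sym (can2_eq arcK arcK).
Qed.

Lemma rank_shift_arc : \rank (shift_mx arc) = fcard arc predT.
Proof.
have := rank_invariants arc_inj; rewrite mxrank_ker.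
have := rank_leq_row (shift_mx arc); have := card_darts; lia.
Qed.

(** In characteristic 2, the image of shift_mx arc lies in its kernel, and
    both have half the dimension of the whole space. *)
Lemma shift_arc_eq : (shift_mx arc :=: invariants arc)%MS.
Proof.
apply/eqmxP; rewrite -(geq_leqif (mxrank_leqif_eq _)).
  by rewrite rank_invariants // rank_shift_arc.
rewrite sub_kermx; apply/eqP/row_matrixP => i; rewrite row_mul row0.
rewrite -[row i _]fun_ofK.
have -> : row i (shift_mx arc)
   = row_of (fun x => (enum_val i == arc x)%:R - (enum_val i == x)%:R : bool).
  by apply/rowP => j; rewrite !mxE.
rewrite fun_ofK row_of_shift; apply/rowP => j; rewrite !mxE arcK.
by case: (_ == arc _); case: (_ == _).
Qed.

Lemma rank_components :
  \rank (invariants next :&: invariants arc)%MS = n_comp (link next arc) predT.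
Proof.
have sym_l : connect_sym (link next arc).
  by apply: relU_sym; apply: fconnect_sym.
have := card_locally_constant bool sym_l; rewrite card_bool.
apply: rank_invariants_cap => u.
apply/'forall_forallP/forallP => [uP x | uP x y].
  have := uP x (next x); have := uP x (arc x).
  by rewrite /link !eqxx orbT /= ![u x == _]eq_sym => -> ->.
have /andP[un ua] := uP x.
by apply/implyP; case/orP=> /eqP <-; rewrite eq_sym.
Qed.

Lemma rank_components_faces :
  \rank (invariants (next \o arc) :&: invariants arc)%MS =
  n_comp (link next arc) predT.
Proof.
rewrite -rank_components.
apply: (rank_invariants_cap (fun u => erefl)).
rewrite -card_bool; apply: (@card_fun_rowspace bool) => u.
rewrite sub_capmx !row_of_invariants.
apply/forallP/andP => [ufg | [/forallP un /forallP ua] x] /=.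
  have ua x : u (arc x) = u x by apply/eqP; case/andP: (ufg x).
  split; apply/forallP => x; last by rewrite ua.
  by case/andP: (ufg (arc x)); rewrite /= arcK ua.
by rewrite (eqP (un _)) ua.
Qed.

Hypothesis planar : (fcard next predT + fcard (next \o arc) predT =
  fcard arc predT + 2 * n_comp (link next arc) predT)%N.

(** Let c, v, e, f be the numbers of components, vertices, edges and faces of
    the map.  The functions G (d) + G (arc d) for G invariant along the faces
    form a space U1 of dimension f - c, as the kernel consists of the locally
    constant functions.  They are flows, and the flows form a space U2 of
    dimension e - v + c, being the orthogonal of the sum of the invariants of
    arc and of next.  Both dimensions agree by Euler's formula. *)
Lemma face_potential (x : T -> bool) :
    (forall d, x (arc d) = x d) ->
    (forall d, \sum_(y | fconnect next d y) x y = 0) ->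
  exists G : T -> bool, (forall d, G (next (arc d)) = G d) /\
    forall d, x d = G d + G (arc d).
Proof.
move=> x_arc x_next.
pose U1 := invariants (next \o arc) *m shift_mx arc.
pose U2 := kermx (row_mx (shift_mx arc) (invariants next)^T).
have orth (y : T -> bool) :
    (forall u : T -> bool, (forall d, u (next d) = u d) ->
       \sum_z y z * u z = 0) ->
    row_of y *m (invariants next)^T = 0.
  move=> y_orth; apply: row_of_mul_tr => j; apply: y_orth => d.
  have : (row_of (fun_of (row j (invariants next))) <= invariants next)%MS.
    by rewrite fun_ofK row_sub.
  by rewrite row_of_invariants => /forallP/(_ d)/eqP.
have U12 : (U1 <= U2)%MS.
  apply/rV_subP => _ /submxP[D ->]; rewrite mulmxA.
  set v := D *m _; have : (row_of (fun_of v) <= invariants (next \o arc))%MS.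
    by rewrite fun_ofK submxMl.
  rewrite row_of_invariants => /forallP Gf; rewrite -(fun_ofK v).
  move: (fun_of v) Gf => G Gf.
  have GE d : G (arc d) = G (next d).
    by rewrite -[in RHS](arcK d); apply/esym/eqP/Gf.
  rewrite row_of_shift sub_kermx mul_mx_row row_of_shift.
  rewrite orth => [|u u_next].
    apply/eqP/rowP => i; case: (split_ordP i) => k ->.
      rewrite row_mxEl !mxE arcK.
      by case: (G (enum_val k)); case: (G (arc _)).
    by rewrite row_mxEr !mxE.
  under eq_bigr => z _ do rewrite GE mulrBl -{1}u_next.
  rewrite sumrB (reindex_inj next_inj (F := fun z => G z * u z)) /=.
  exact: subrr.
have rk1 : \rank U1 = \rank U2.
  have := mxrank_mul_ker (invariants (next \o arc)) (shift_mx arc).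
  rewrite rank_components_faces rank_invariants; last exact: inj_comp.
  rewrite -/U1 mxrank_ker -[\rank (row_mx _ _)]mxrank_tr tr_row_mx trmxK tr_shift_arc -addsmxE.
  rewrite (adds_eqmx shift_arc_eq (eqmx_refl _)).
  have := mxrank_sum_cap (invariants arc) (invariants next).
  rewrite capmxC rank_components !rank_invariants //.
  by have := card_darts; move: planar; lia.
have U21 : (U2 <= U1)%MS by rewrite -(geq_leqif (mxrank_leqif_sup U12)) rk1.
have /submxP[D xD] : (row_of x <= U1)%MS.
  apply: submx_trans U21; rewrite sub_kermx mul_mx_row row_of_shift.
  rewrite orth => [|u u_next].
    apply/eqP/rowP => i; case: (split_ordP i) => k ->.
      by rewrite row_mxEl !mxE x_arc subrr.
    by rewrite row_mxEr !mxE.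
  rewrite (partition_big (froot next) (froots next)) => [|z _] /=; last first.
    exact: roots_root (fconnect_sym next_inj) z.
  apply: big1 => z _.
  have u_cst y : froot next y == z -> u y = u z.
    move/eqP <-; apply: (@fconnect_invariant _ next _ u) => [w|].
      by rewrite inE /= u_next eqxx.
    exact: connect_root.
  transitivity ((\sum_(y | froot next y == z) x y) * u z).
    by rewrite mulr_suml; apply: eq_bigr => y /u_cst ->.
  have [/eqP zr | zr] := boolP (froots next z).
    rewrite -{1}zr (eq_bigl (fconnect next z)) ?x_next ?mul0r // => y.
    by rewrite eq_sym root_connect //; apply: fconnect_sym.
  rewrite big_pred0 ?mul0r // => y; apply: contraNF zr => /eqP <-.
  exact: roots_root (fconnect_sym next_inj) y.
pose G := fun_of (D *m invariants (next \o arc)).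
have GE : row_of G = D *m invariants (next \o arc) by rewrite fun_ofK.
exists G; split=> [d | d].
  have : (row_of G <= invariants (next \o arc))%MS by rewrite GE submxMl.
  by rewrite row_of_invariants => /forallP/(_ d)/eqP.
have := congr1 (fun w => fun_of w d) xD.
rewrite /U1 mulmxA -GE row_of_shift.
by rewrite !row_ofE => ->; case: (G (arc d)); case: (G d).
Qed.

End Planarity.

(** * The Yamada polynomial at 1 as a sum over Klein flows of the projection *)

Lemma big_Z4 (R : Type) (idx : R) (op : Monoid.law idx) (F : 'Z_4 -> R) :
  \big[op/idx]_i F i = op (F 0) (op (F 1) (op (F 2%:R) (F 3%:R))).
Proof.
rewrite !big_ord_recl big_ord0 Monoid.mulm1.
by congr (op (F _) (op (F _) (op (F _) (F _)))); apply: val_inj.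
Qed.

Section States.

Variables (G : graph) (S : ribbon G) (D : diagram S).

Notation dartD := (dart G (crossing D)).
Notation arcD := (@Defs.arc G S D).

Lemma resolveK r : involutive (resolve r).
Proof. by case: r => i; rewrite /resolve ?subKr. Qed.

Lemma resolve_fixed r i : (resolve r i == i) = (r == Vertex4).
Proof.
have -> : (r == Vertex4) = (if r is Vertex4 then true else false).
  by case: r; apply/eqP.
by case: r; rewrite /resolve ?eqxx //; case: i => [[|[|[|[|]]]] ?].
Qed.

Section OneState.

Variable s : {ffun crossing D -> resolution}.

Notation res := (@resolved G S D s).
Notation is_endD := (@is_end G S D s).

Lemma resolvedK : involutive res.
Proof. by case=> [h|[c i]] //=; rewrite resolveK. Qed.

Lemma resolved_fixed d : (res d == d) = is_endD d.
Proof.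
case: d => [h|[c i]] /=; first by rewrite eqxx.
rewrite -(resolve_fixed _ i); apply/eqP/eqP => [[->] | ->] //.
Qed.

Lemma strand_connect_sym : connect_sym (link arcD res).
Proof. exact: link_sym (@arcK _ _ D) resolvedK. Qed.

Definition strand_set d : {set dartD} := [set d' | connect (link arcD res) d d'].

Lemma strand_setP d : strand_set d \in strands s.
Proof. exact: imset_f. Qed.

Definition strand_of d : state_edge s :=
  exist (fun B => B \in strands s) _ (strand_setP d).

Lemma strand_of_eq d d' :
  (strand_of d == strand_of d') = connect (link arcD res) d d'.
Proof.
rewrite -val_eqE /=; apply/eqP/idP => [dd' | dd'].
  have : d' \in strand_set d' by rewrite inE.
  by rewrite -dd' inE.
by apply/setP => x; rewrite !inE (same_connect strand_connect_sym dd').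
Qed.

Lemma mem_strand (B : state_edge s) d : (d \in val B) = (B == strand_of d).
Proof.
have /imsetP[x _ BE] := valP B.
have {BE}-> : B = strand_of x by apply: val_inj.
by rewrite strand_of_eq inE.
Qed.

Lemma at_node_end (w : node s) d : at_node w d -> is_endD d.
Proof.
case: w => [v|[c cP]]; case: d => [h|[c' i]] //= /eqP <-; exact: cP.
Qed.

Lemma end_node d : is_endD d ->
  exists w : node s, forall w', at_node w' d = (w' == w).
Proof.
case: d => [h _|[c i] /= cP].
  by exists (inl (foot h)) => -[v|c] //=; rewrite eq_sym.
by exists (inr (exist (fun c => s c == Vertex4) c cP)) => -[v|c'].
Qed.

(** A strand contains no end, if it is a circle, or exactly two ends by
    other_end.  The pair p orients it, and its third property says that the
    incidence of the strand with a node is the parity of its ends there. *)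
Lemma state_ends_pair (B : state_edge s) :
  exists p : state_vertex s * state_vertex s,
  [/\ state_ends B = [set p.1; p.2],
      forall C, (p.1 == inr C) = (p.2 == inr C),
      forall w, (p.2 == inl w)%:R - (p.1 == inl w)%:R
        = \sum_(d in val B) (at_node w d)%:R :> bool
    & #|[set d in val B | is_endD d]|
        = if is_circle s (val B) then 0%N else 2%N].
Proof.
have [d1 /andP[d1B d1e] | no_end] := pickP (fun d => (d \in val B) && is_endD d);
    last first.
  have circB : is_circle s (val B).
    rewrite /is_circle (valP B) /=; apply/forall_inP => d dB.
    by apply: contraFN (no_end d) => ->; rewrite dB.
  pose C0 : {B | is_circle s B} := exist _ (val B) circB.
  exists (inr C0, inr C0); split=> //=.
  - apply/setP => -[w|C]; rewrite !inE /=.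
      apply/exists_inP => -[d dB /at_node_end de].
      by have := no_end d; rewrite dB de.
    by rewrite orbb.
  - move=> w; rewrite subrr big1 // => d dB.
    case: (boolP (at_node w d)) => // /at_node_end de.
    by have := no_end d; rewrite dB de.
  rewrite circB; apply/eqP; rewrite cards_eq0 -subset0; apply/subsetP => d.
  by rewrite inE no_end.
have BE : B = strand_of d1 by apply/eqP; rewrite -mem_strand.
have rd1 : res d1 = d1 by apply/eqP; rewrite resolved_fixed.
have [d2 [d21 rd2 d12] only] :=
  other_end (@arcK _ _ D) resolvedK (@arc_neq _ _ D) rd1.
have d2e : is_endD d2 by rewrite -resolved_fixed rd2.
have d2B : d2 \in val B by rewrite BE inE.
have endsB d : (d \in val B) && is_endD d = (d == d1) || (d == d2).
  apply/andP/orP => [[dB] | [/eqP->|/eqP->] //].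
  rewrite -resolved_fixed => /eqP rd; move: dB; rewrite BE inE => dB.
  by case: (only d dB rd) => ->; rewrite eqxx; [left|right].
have [w1 w1P] := end_node d1e; have [w2 w2P] := end_node d2e.
have ncircB : is_circle s (val B) = false.
  apply/negbTE/negP => /andP[_ /forall_inP/(_ d1 d1B)].
  by rewrite d1e.
exists (inl w1, inl w2); split=> //=.
- apply/setP => -[w|C]; rewrite !inE /=.
    apply/exists_inP/orP => [[d dB dw] | []].
    + have := endsB d; rewrite dB (at_node_end dw) => /esym/orP[]/eqP dE.
        by left; rewrite dE w1P in dw; rewrite (eqP dw).
      by right; rewrite dE w2P in dw; rewrite (eqP dw).
    + by move/eqP=> [->]; exists d1; rewrite ?w1P.
    by move/eqP=> [->]; exists d2; rewrite ?w2P.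
  by apply/negbTE/negP => /eqP CB; have := valP C; rewrite /= CB ncircB.
- move=> w; rewrite (bigD1 d1) //= (bigD1 d2) /=; last by rewrite d2B d21.
  rewrite big1 ?addr0 => [|d /andP[/andP[dB dd1] dd2]].
    rewrite w1P w2P -[inl w1 == _]/(w1 == w) -[inl w2 == _]/(w2 == w) ![w == _]eq_sym.
    by case: (w1 == w); case: (w2 == w).
  case: (boolP (at_node w d)) => // /at_node_end de.
  by have := endsB d; rewrite dB de (negbTE dd1) (negbTE dd2).
rewrite ncircB -[RHS](_ : #|[set d1; d2]| = 2%N); last by rewrite cards2 eq_sym d21.
by apply: eq_card => d; rewrite !inE endsB.
Qed.

Lemma card_ends :
  #|[set d | is_endD d]| = (2 * #|edge G| + 4 * #|[set c | s c == Vertex4]|)%N.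
Proof.
rewrite -sum1_card big_mkcond big_sumType /=; congr (_ + _)%N.
  rewrite (eq_bigr (fun=> 1%N)) => [|h _]; last by rewrite inE.
  by rewrite sum1_card card_prod card_bool mulnC.
rewrite (eq_bigr (fun p => (s p.1 == Vertex4 : nat))) => [|[c i] _]; last first.
  by rewrite inE /=; case: (s c == _).
rewrite -(pair_bigA _ (fun c (_ : 'Z_4) => (s c == Vertex4 : nat))) /=.
rewrite -sum1_card big_distrr [RHS]big_mkcond; apply: eq_bigr => c _ /=.
by rewrite sum_nat_const card_ord inE; case: (s c == _).
Qed.

(** A circle counts once as a vertex and once as an edge.  The other strands are
    half as many as the ends, by state_ends_pair. *)
Lemma state_sign : (-1) ^+ (#|state_vertex s| + #|state_edge s|)
  = (-1) ^+ (#|vertex G| + #|edge G|) * \prod_c (-1) ^+ (s c == Vertex4) :> int.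
Proof.
pose circs := [set B : state_edge s | is_circle s (val B)].
have vE : #|state_vertex s|
    = (#|vertex G| + #|[set c | s c == Vertex4]| + #|circs|)%N.
  rewrite !card_sum; congr (_ + _ + _)%N.
    by rewrite card_sig cardsE.
  rewrite card_sig -[RHS](card_imset _ val_inj); apply: eq_card => B.
  apply/idP/imsetP => [circB | [B' + ->]]; last by rewrite inE.
  have /andP[BP _] := circB.
  by exists (exist (fun B => B \in strands s) B BP); rewrite ?inE.
have ends2 : #|[set d | is_endD d]| = (2 * #|~: circs|)%N.
  transitivity (\sum_(B : state_edge s) #|[set d in val B | is_endD d]|).
    rewrite -sum1_card (partition_big strand_of predT) //=.
    apply: eq_bigr => B _; rewrite -sum1_card; apply: eq_bigl => d.
    by rewrite !inE mem_strand eq_sym andbC.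
  rewrite -sum1_card big_distrr /= [RHS]big_mkcond; apply: eq_bigr => B _ /=.
  have [p [_ _ _ ->]] := state_ends_pair B; rewrite !inE.
  by case: (is_circle s _).
have eE : #|state_edge s| = (#|circs| + #|~: circs|)%N by rewrite cardsC.
have := ends2; rewrite card_ends => e2.
have -> : (#|state_vertex s| + #|state_edge s| =
  #|vertex G| + #|edge G| + #|[set c | s c == Vertex4]|
     + 2 * (#|circs| + #|[set c | s c == Vertex4]|))%N by lia.
rewrite exprD exprM expr2 mulrNN mulr1 expr1n mulr1 exprD; congr (_ * _).
rewrite -prodr_const big_mkcond; apply: eq_bigr => c _ /=.
by rewrite inE; case: (s c == _).
Qed.

End OneState.

Definition balanced (u : dartD -> bool) : bool :=
  [forall v, \sum_(h | foot h == v) u (inl h) == 0]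
  && [forall c, \sum_i u (inr (c, i)) == 0].

(** A nowhere-zero flow of the planar 4-valent projection with values in
    bool * bool, the Klein four-group. *)
Definition klein_flow (z : dartD -> bool * bool) : bool :=
  [&& [forall d, z (arcD d) == z d], [forall d, z d != (false, false)],
      balanced (fun d => (z d).1) & balanced (fun d => (z d).2)].

Definition compatible (r : resolution) (c : crossing D)
    (z : dartD -> bool * bool) : bool :=
  [forall i, z (inr (c, resolve r i)) == z (inr (c, i))].

(** A flow on the state is a function of darts that is constant on strands.  At
    a smoothed crossing the four values are pairwise equal, hence their sum
    vanishes automatically, and such functions are Klein flows of the
    unresolved projection. *)
Lemma card_state_flows (s : {ffun crossing D -> resolution}) :
  (flow_polynomial (state_ends (s := s))).[4%:R] =
  #|[set z : {ffun dartD -> bool * bool} |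
      klein_flow z && [forall c, compatible (s c) c z]]|%:R.
Proof.
have [p pP] := fin_all_exists (state_ends_pair (s := s)).
pose t B := (p B).1; pose h B := (p B).2.
have endsE B : state_ends B = [set t B; h B] by have [] := pP B.
have flowE (x : state_edge s -> bool) : is_flow t h x =
    [forall w : node s, \sum_d x (strand_of s d) * (at_node w d)%:R == 0].
  have sumE (w : node s) : \sum_B x B * incidence bool t h B (inl w) =
      \sum_d x (strand_of s d) * (at_node w d)%:R.
    rewrite [RHS](partition_big (strand_of s) predT) //=.
    apply: eq_bigr => B _; rewrite /incidence /t /h.
    have [_ _ -> _] := pP B; rewrite big_distrr /=; apply: eq_big => d.
      by rewrite mem_strand eq_sym.
    by rewrite mem_strand => /eqP ->.
  apply/forallP/forallP => [xf w | xf [w|C]].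
  - by have := xf (inl w); rewrite sumE.
  - by rewrite sumE; apply: xf.
  rewrite big1 // => B _; rewrite /incidence /t /h.
  by have [_ -> _ _] := pP B; rewrite subrr mulr0.
have rep_ex (B : state_edge s) : exists d, B = strand_of s d.
  by have /imsetP[d _ dB] := valP B; exists d; apply: val_inj.
have [rep repE] := fin_all_exists rep_ex.
have nodesE (u : dartD -> bool) : (forall d, u (resolved s d) = u d) ->
   [forall w : node s, \sum_d u d * (at_node w d : bool)%:R == 0 :> bool]
    = balanced u.
  move=> u_res.
  have nodeV v : \sum_d u d * (at_node (inl v : node s) d : bool)%:R
      = \sum_(h | foot h == v) u (inl h).
    rewrite big_sumType /= [X in _ + X]big1 ?addr0 => [|d _]; last exact: mulr0.
    rewrite [RHS]big_mkcond; apply: eq_bigr => e _.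
    by case: (_ == v); rewrite ?mulr1 ?mulr0.
  have nodeX (c : {c | s c == Vertex4}) :
      \sum_d u d * (at_node (inr c : node s) d : bool)%:R
      = \sum_i u (inr (val c, i)).
    rewrite big_sumType /= big1 ?add0r => [|d _]; last exact: mulr0.
    transitivity (\sum_(q : crossing D * 'Z_4) u (inr (q.1, q.2)) * (val c == q.1)%:R).
      by apply: eq_bigr => -[].
    rewrite -(pair_bigA _ (fun c' i => u (inr (c', i)) * (val c == c')%:R)) /=.
    rewrite (bigD1 (val c)) //= [X in _ + X]big1 ?addr0 => [|c' ne].
      by apply: eq_bigr => i _; rewrite eqxx mulr1.
    by apply: big1 => i _; rewrite eq_sym (negbTE ne) mulr0.
  apply/forallP/andP => [uw | [/forallP uv /forallP uc] [v|c]].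
  - split; [apply/forallP => v | apply/forallP => c]; first by rewrite -nodeV.
    have [sc | sc] := boolP (s c == Vertex4).
      by have := uw (inr (exist _ c sc)); rewrite nodeX.
    have ur i : u (inr (c, resolve (s c) i)) = u (inr (c, i)).
      exact: u_res (inr (c, i)).
    rewrite big_Z4; move: sc ur; case: (s c) => /= [_ ur | _ ur | /eqP//].
      rewrite -(ur 0) -(ur 1) (_ : -1 - 0 = 3%:R); last exact: val_inj.
      rewrite (_ : -1 - 1 = 2%:R); last exact: val_inj.
      by case: (u _); case: (u _).
    rewrite -(ur 0) -(ur 2%:R) (_ : 1 - 0 = 1) ?subr0 //.
    rewrite (_ : 1 - 2%:R = 3%:R); last exact: val_inj.
    by case: (u _); case: (u _).
  - by rewrite nodeV.
  by rewrite nodeX.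
have strand_arc d : strand_of s (arcD d) = strand_of s d.
  apply/eqP; rewrite strand_of_eq strand_connect_sym; apply: connect1.
  by rewrite /link eqxx.
have strand_res d : strand_of s (resolved s d) = strand_of s d.
  apply/eqP; rewrite strand_of_eq strand_connect_sym; apply: connect1.
  by rewrite /link eqxx orbT.
have flow_strand (x : state_edge s -> bool) (u : dartD -> bool) :
    (forall d, u d = x (strand_of s d)) -> is_flow t h x = balanced u.
  move=> ux; rewrite flowE -nodesE => [|d]; last by rewrite !ux strand_res.
  by apply: eq_forallb => w; congr (_ == _); apply: eq_bigr => d _; rewrite ux.
have -> : 4%:R = (#|{: bool}| ^ 2)%:R :> int by rewrite card_bool.
rewrite (flow_polynomial_card2 bool endsE); congr (_%:R).
apply: (@card_bij_on _ _ _
  (fun z : {ffun dartD -> bool * bool} => klein_flow z && [forall c, compatible (s c) c z])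
  (fun xy : {ffun state_edge s -> bool} * {ffun state_edge s -> bool} =>
     [ffun d => (xy.1 (strand_of s d), xy.2 (strand_of s d))])
  (fun z : {ffun dartD -> bool * bool} =>
     ([ffun B => (z (rep B)).1], [ffun B => (z (rep B)).2]))).
- move=> [x y] /= /andP[/andP[fx fy] nz]; split.
    apply/andP; split.
      apply/and4P; split.
      + by apply/forallP => d; rewrite !ffunE strand_arc.
      + apply/forallP => d; rewrite ffunE; have := forallP nz (strand_of s d).
        by case: (x _); case: (y _).
      + by rewrite -(flow_strand x) // => d; rewrite ffunE.
      by rewrite -(flow_strand y) // => d; rewrite ffunE.
    apply/'forall_forallP => c i; rewrite !ffunE.
    by rewrite -(strand_res (inr (c, i))).
  by congr (_, _); apply/ffunP => B; rewrite !ffunE -repE.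
move=> z /andP[/and4P[z_arc z_nz z1 z2] z_res].
have z_con d : z (rep (strand_of s d)) = z d.
  apply: (connect_link_invariant (a := arcD) (r := resolved s)) => [d'|d'|].
  - exact/eqP/(forallP z_arc).
  - by case: d' => [e|[c i]] //=; apply/eqP/(forallP (forallP z_res c)).
  by rewrite -strand_of_eq -repE.
split; last by apply/ffunP => d; rewrite !ffunE z_con -surjective_pairing.
have z_flow (pr : bool * bool -> bool) :
    balanced (fun d => pr (z d)) -> is_flow t h [ffun B => pr (z (rep B))].
  by rewrite (flow_strand _ (fun d => pr (z d))) // => d; rewrite ffunE z_con.
rewrite /= (z_flow fst) ?(z_flow snd) //=.
apply/forallP => B; rewrite !ffunE; have := forallP z_nz (rep B).
by case: (z (rep B)) => -[] [].
Qed.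

(** By card_state_flows, the set of Klein flows that contribute to a state is
    given by a local condition at each crossing.  As the sign of the state is
    local too, the sum over all states is a product over the crossings. *)
Lemma yamada_klein :
  yamada D (1 : int) = (-1) ^+ (#|vertex G| + #|edge G|) *
  \sum_(z : {ffun dartD -> bool * bool} | klein_flow z)
    \prod_c \sum_(r : resolution) (-1) ^+ (r == Vertex4) * (compatible r c z)%:R.
Proof.
rewrite /yamada.
transitivity (\sum_(s : {ffun crossing D -> resolution})
  \sum_(z : {ffun dartD -> bool * bool} | klein_flow z)
  (-1) ^+ (#|vertex G| + #|edge G|) * \prod_c
     ((-1) ^+ (s c == Vertex4) * (compatible (s c) c z)%:R) : int).
  apply: eq_bigr => s _.
  rewrite big1 ?mul1r => [|c _]; last by case: (s c).
  rewrite /planar_yamada state_sign.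
  rewrite (_ : map_poly _ _ = flow_polynomial (state_ends (s:=s))); last first.
    by rewrite map_poly_id // => x _; rewrite intz.
  rewrite (_ : 1 + 2%:R + 1^-1 = 4%:R) // card_state_flows.
  rewrite -sum1_card natr_sum !big_distrr /= big_mkcond [RHS]big_mkcond.
  apply: eq_bigr => z _ /=; rewrite inE; case: (klein_flow z) => //=.
  rewrite big_split /= -mulrA; case: ifP => [/forallP zc | /negbT].
    by congr (_ * (_ * _)); rewrite big1 // => c _; rewrite zc.
  by rewrite negb_forall => /existsP[c /negbTE nc];
    rewrite (bigD1 c (F := fun c => (compatible _ _ _)%:R)) //= nc mul0r !mulr0.
rewrite exchange_big big_distrr /=; apply: eq_bigr => z _.
by rewrite -big_distrr /= bigA_distr_bigA.
Qed.

End States.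

(** * Signs of flows and the Penrose number *)

Definition o0 : 'I_3 := Ordinal (isT : 0 < 3)%N.
Definition o1 : 'I_3 := Ordinal (isT : 1 < 3)%N.
Definition o2 : 'I_3 := Ordinal (isT : 2 < 3)%N.

Lemma big_I3 (R : Type) (idx : R) (op : Monoid.com_law idx) (F : 'I_3 -> R) :
  \big[op/idx]_i F i = op (F o0) (op (F o1) (F o2)).
Proof.
rewrite !big_ord_recl big_ord0 Monoid.mulm1.
by congr (op (F _) (op (F _) (F _))); apply: val_inj.
Qed.

Lemma big_corners (V E : finType) (phi : V * 'I_3 -> E * bool) (R : Type)
    (idx : R) (op : Monoid.com_law idx) (F : E * bool -> R) : bijective phi ->
  \big[op/idx]_h F h = \big[op/idx]_v
    op (F (phi (v, o0))) (op (F (phi (v, o1))) (F (phi (v, o2)))).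
Proof.
case=> psi phiK psiK.
rewrite (reindex phi) /=; last by exists psi => ? _; rewrite ?phiK ?psiK.
rewrite (eq_bigr (fun p => F (phi (p.1, p.2)))) => [|[v k] _] //.
rewrite -(pair_bigA _ (fun v k => F (phi (v, k)))) /=.
by apply: eq_bigr => v _; rewrite big_I3.
Qed.

(** Labels of the half-edges of a cubic ribbon graph: phi (v, k) is the k-th
    half-edge around v. *)
Definition corner_labels (G : graph) (S : ribbon G)
    (phi : vertex G * 'I_3 -> half_edge G) : Prop :=
  [/\ bijective phi, forall v k, foot (phi (v, k)) = v,
      forall v, Defs.rot S (phi (v, o0)) = phi (v, o1),
      forall v, Defs.rot S (phi (v, o1)) = phi (v, o2)
    & forall v, Defs.rot S (phi (v, o2)) = phi (v, o0)].

Lemma cubic_corner_labels (G : graph) (S : ribbon G) : cubic G ->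
  exists phi, corner_labels S phi.
Proof.
move=> cubicG.
have base_ex v : exists h : half_edge G, foot h == v.
  have : (0 < degree v)%N by rewrite cubicG.
  by case/card_gt0P => h; rewrite inE; exists h.
have [b bP] := fin_all_exists base_ex.
have rot_inj : injective (Defs.rot S) := @perm_inj _ _.
have order3 v : fingraph.order (Defs.rot S) (b v) = 3%N.
  rewrite -(cubicG v); apply: eq_card => h.
  by rewrite inE -[LHS]/(fconnect _ _ _) rot_cyclic (eqP (bP v)) eq_sym.
have foot_iter v k : foot (iter k (Defs.rot S) (b v)) = v.
  by apply/eqP; rewrite -[X in _ == X](eqP (bP v)) eq_sym -(rot_cyclic S) fconnect_iter.
pose phi (p : vertex G * 'I_3) := iter p.2 (Defs.rot S) (b p.1).
exists phi; split=> //.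
- apply: inj_card_bij => [[v k] [v' k']|]; rewrite /phi /=.
    move=> eq_phi.
    have vv : v = v' by rewrite -(foot_iter v k) eq_phi foot_iter.
    rewrite -vv in eq_phi *; congr (_, _); apply: val_inj => /=.
    by rewrite -(@findex_iter _ (Defs.rot S) (b v) k) ?order3 // eq_phi
      findex_iter ?order3.
  have -> : #|{: vertex G * 'I_3}| = (#|vertex G| * 3)%N.
    by rewrite card_prod card_ord.
  rewrite -sum1_card (partition_big (@foot G) predT) //=.
  rewrite -sum_nat_const leq_sum // => v _.
  by rewrite sum1_card -(cubicG v) /degree cardsE.
- by move=> v k; apply: foot_iter.
by move=> v; rewrite -[RHS](iter_order rot_inj) order3.
Qed.

Definition levi_civita (i j k : nat) : int :=
  match i, j, k with
  | 0%N, 1%N, 2%N | 1%N, 2%N, 0%N | 2%N, 0%N, 1%N => 1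
  | 0%N, 2%N, 1%N | 2%N, 1%N, 0%N | 1%N, 0%N, 2%N => -1
  | _, _, _ => 0
  end.

(* the value on the neutral element is an index at which levi_civita is 0 *)
Definition klein_index (x : bool * bool) : nat :=
  match x with
  | (true, false) => 0
  | (false, true) => 1
  | (true, true) => 2
  | (false, false) => 3
  end%N.

Definition of_color (i : 'I_3) : bool * bool :=
  match val i with 0%N => (true, false) | 1%N => (false, true) | _ => (true, true) end.

Definition to_color (x : bool * bool) : 'I_3 :=
  match x with (true, false) => o0 | (false, true) => o1 | _ => o2 end.

Lemma of_colorK : cancel of_color to_color.
Proof. by case=> [[|[|[|]]] ?] //; apply: val_inj. Qed.

Lemma to_colorK x : x != (false, false) -> of_color (to_color x) = x.
Proof. by case: x => [[] []]. Qed.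

Lemma klein_index_color i : klein_index (of_color i) = i.
Proof. by case: i => [[|[|[|]]] ?]. Qed.

(** The sign of the product of g^-1 and g', where g and g' are read as the
    elements 1, i, j, k of the quaternion group. *)
Definition quaternion_sign (g g' : bool * bool) : bool :=
  match klein_index g, klein_index g' with
  | 0%N, 1%N | 1%N, 2%N | 2%N, 0%N => true
  | 3%N, _ => false
  | _, 3%N => true
  | _, _ => false
  end.

Definition kadd (x y : bool * bool) : bool * bool := (x.1 (+) y.1, x.2 (+) y.2).

Lemma quaternion_sign_swap g g' : kadd g g' != (false, false) ->
  quaternion_sign g' g = ~~ quaternion_sign g g'.
Proof. by case: g => [[] []]; case: g' => [[] []]. Qed.

(** With g^-1 g' = s(g, g') e(g + g'), where s is a sign and e(x) is the
    quaternion unit of x, the cyclic product of the left-hand sides is 1.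
    Hence the product of the signs is that of three distinct units, - 1 or 1
    according to their cyclic order. *)
Lemma quaternion_triangle g0 g1 g2 :
    kadd g0 g1 != (false, false) -> kadd g1 g2 != (false, false) ->
    kadd g2 g0 != (false, false) ->
  (-1) ^+ quaternion_sign g0 g1 * ((-1) ^+ quaternion_sign g1 g2
    * (-1) ^+ quaternion_sign g2 g0) =
  - levi_civita (klein_index (kadd g0 g1)) (klein_index (kadd g1 g2))
      (klein_index (kadd g2 g0)) :> int.
Proof.
by case: g0 => [[] []]; case: g1 => [[] []]; case: g2 => [[] []].
Qed.

(** As for the triangle: the product of the units is e e' e e', which is 1 if
    e = e' and - 1 otherwise. *)
Lemma quaternion_square g0 g1 g2 g3 :
    kadd g0 g1 != (false, false) -> kadd g1 g2 != (false, false) ->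
    kadd g0 g1 = kadd g2 g3 -> kadd g1 g2 = kadd g3 g0 ->
  (-1) ^+ quaternion_sign g0 g1 * ((-1) ^+ quaternion_sign g1 g2
    * ((-1) ^+ quaternion_sign g2 g3 * (-1) ^+ quaternion_sign g3 g0)) =
  (if kadd g0 g1 == kadd g1 g2 then 1 else -1) :> int.
Proof.
by case: g0 => [[] []]; case: g1 => [[] []]; case: g2 => [[] []];
  case: g3 => [[] []].
Qed.

Lemma sum_resolution (F : resolution -> int) :
  \sum_r F r = F Smooth0 + (F Smooth1 + F Vertex4).
Proof.
rewrite (reindex resolution_of_ord) /=.
  by rewrite big_I3.
exists ord_of_resolution => [i _ | r _]; last exact: ord_of_resolutionK.
by case: i => [[|[|[|]]] ?] //; apply: val_inj; rewrite /= inordK.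
Qed.

Lemma forall_Z4 (P : pred 'Z_4) :
  [forall i, P i] = [&& P 0, P 1, P 2%:R & P 3%:R].
Proof.
apply/forallP/and4P => [PP | [P0 P1 P2 P3] i]; first by split.
have : i \in [:: 0; 1; 2%:R; 3%:R] by case: i => [[|[|[|[|]]]] ?].
by rewrite !inE => /or4P[]/eqP->.
Qed.

Section Penrose.

Variables (G : graph) (S : ribbon G) (D : diagram S).
Variable phi : vertex G * 'I_3 -> half_edge G.
Hypothesis phiP : corner_labels S phi.

Notation dartD := (dart G (crossing D)).
Notation arcD := (@Defs.arc G S D).
Notation acrossD := (@across G (crossing D)).

Definition straight (z : dartD -> bool * bool) : bool :=
  [forall d, z (acrossD d) == z d].

Definition crossing_sign (z : dartD -> bool * bool) (c : crossing D) : int :=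
  if z (inr (c, 0)) == z (inr (c, 1)) then 1 else -1.

Definition vertex_sign (z : dartD -> bool * bool) (v : vertex G) : int :=
  levi_civita (klein_index (z (inl (phi (v, o0)))))
    (klein_index (z (inl (phi (v, o1))))) (klein_index (z (inl (phi (v, o2))))).

Lemma straightE z : straight z =
  [forall c, (z (inr (c, 2%:R)) == z (inr (c, 0)))
             && (z (inr (c, 3%:R)) == z (inr (c, 1)))].
Proof.
apply/forallP/forallP => [zs c | zs [h|[c i]] //=].
  have /= := zs (inr (c, 0)); rewrite (_ : 0 + 2%:R = 2%:R) ?add0r // => ->.
  by have /= := zs (inr (c, 1)); rewrite (_ : 1 + 2%:R = 3%:R) //; apply: val_inj.
have /andP[/eqP z2 /eqP z3] := zs c.
have : [forall i : 'Z_4, z (inr (c, i + 2%:R)) == z (inr (c, i))].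
  rewrite forall_Z4 add0r z2 eqxx /=.
  rewrite (_ : 1 + 2%:R = 3%:R) ?z3 ?eqxx /=; last exact: val_inj.
  rewrite (_ : 2%:R + 2%:R = 0) ?z2 ?eqxx /=; last exact: val_inj.
  by rewrite (_ : 3%:R + 2%:R = 1) ?z3 ?eqxx /=; last exact: val_inj.
by move/forallP.
Qed.

(** Up to exchange of colours, the values around a crossing are aaaa, aabb, abba
    or abab.  The first is compatible with all resolutions and contributes
    1 + 1 - 1, the next two are compatible with one smoothing and contribute
    1 - 1, the last one contributes - 1. *)
Lemma crossing_sum (z : dartD -> bool * bool) c : klein_flow z ->
  \sum_(r : resolution) (-1) ^+ (r == Vertex4) * (compatible r c z)%:R =
  if (z (inr (c, 2%:R)) == z (inr (c, 0)))
     && (z (inr (c, 3%:R)) == z (inr (c, 1)))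
  then crossing_sign z c else 0.
Proof.
case/and4P=> _ /forallP nz /andP[_ /forallP/(_ c) z1] /andP[_ /forallP/(_ c) z2].
rewrite sum_resolution /compatible !forall_Z4 /=.
rewrite eqxx (_ : (Smooth0 == Vertex4) = false); last exact/eqP.
rewrite (_ : (Smooth1 == Vertex4) = false); last exact/eqP.
have Z4 : (-1 - 1 = 2%:R :> 'Z_4) * (-1 - 2%:R = 1 :> 'Z_4)
    * (-1 - 3%:R = 0 :> 'Z_4) * (1 - 1 = 0 :> 'Z_4) * (1 - 2%:R = 3%:R :> 'Z_4)
    * (1 - 3%:R = 2%:R :> 'Z_4) * (1 - 0 = 1 :> 'Z_4).
  by do !split; apply: val_inj.
rewrite /= !Z4 subr0 (_ : -1 = 3%:R :> 'Z_4); last exact: val_inj.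
rewrite /crossing_sign; move: z1 z2; rewrite !big_Z4.
move: (nz (inr (c, 0))) (nz (inr (c, 1))) (nz (inr (c, 2%:R))) (nz (inr (c, 3%:R))).
case: (z (inr (c, 0))) => [[] []] //=; case: (z (inr (c, 1))) => [[] []] //=;
case: (z (inr (c, 2%:R))) => [[] []] //=; case: (z (inr (c, 3%:R))) => [[] []] //=.
Qed.

Lemma yamada_straight :
  yamada D (1 : int) = (-1) ^+ (#|vertex G| + #|edge G|) *
  \sum_(z : {ffun dartD -> bool * bool} | klein_flow z && straight z)
    \prod_c crossing_sign z c.
Proof.
rewrite yamada_klein; congr (_ * _); rewrite [RHS]big_mkcondr /=.
apply: eq_bigr => z zf; rewrite straightE; case: ifP => [/forallP zs | /negbT].
  by apply: eq_bigr => c _; rewrite crossing_sum // zs.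
rewrite negb_forall => /existsP[c /negbTE zc].
by rewrite (bigD1 c) //= crossing_sum // zc mul0r.
Qed.

End Penrose.
Lemma next_dart_inj (G : graph) (X : finType) (S : ribbon G) :
  injective (@next_dart G X S).
Proof.
move=> [h|[c i]] [h'|[c' i']] //=; first by move=> [/perm_inj ->].
move/eqP; rewrite -[_ == _]/((c == c') && (i + 1 == i' + 1)).
by case/andP=> /eqP-> /eqP/addIr->.
Qed.

Lemma fconnect_next_dart (G : graph) (X : finType) (S : ribbon G) (d d' : dart G X) :
  fconnect (next_dart S) d d' =
  match d, d' with
  | inl h, inl h' => foot h == foot h'
  | inr (c, _), inr (c', _) => c == c'
  | _, _ => false
  end.
Proof.
pose site (d : dart G X) : vertex G + X :=
  match d with inl h => inl (foot h) | inr (c, _) => inr c end.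
transitivity (site d == site d'); last first.
  by case: d => [h|[c i]]; case: d' => [h'|[c' i']].
apply/idP/eqP => [dd' | ].
  apply: (@fconnect_invariant _ (next_dart S) _ site _ _ _ dd') => -[h|[c i]] /=.
    apply/eqP; congr inl; apply/esym/eqP.
    by rewrite -(rot_cyclic S) fconnect1.
  by rewrite eqxx.
case: d => [h|[c i]]; case: d' => [h'|[c' i']] //= [].
  move/eqP; rewrite -(rot_cyclic S) => /iter_findex <-.
  set k := findex _ _ _.
  have -> : inl (iter k (Defs.rot S) h) = iter k (next_dart S) (inl h) :> dart G X.
    by elim: k => //= k <-.
  exact: fconnect_iter.
move=> <-; pose k : 'Z_4 := i' - i.
have -> : inr (c, i') = iter k (next_dart S) (inr (c, i)) :> dart G X.
  have iterE n : iter n (next_dart S) (inr (c, i)) = inr (c, i + n%:R) :> dart G X.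
    by elim: n => [|n /= ->]; rewrite ?addr0 //= -natr1 addrA.
  by rewrite iterE natr_Zp /k addrC subrK.
exact: fconnect_iter.
Qed.

Section PenroseSum.

Variables (G : graph) (S : ribbon G) (D : diagram S).
Variable phi : vertex G * 'I_3 -> half_edge G.
Hypothesis phiP : corner_labels S phi.

Notation dartD := (dart G (crossing D)).
Notation arcD := (@Defs.arc G S D).
Notation acrossD := (@across G (crossing D)).

Lemma sum_at_vertex (M : nmodType) (F : half_edge G -> M) v :
  \sum_(h | foot h == v) F h =
  F (phi (v, o0)) + (F (phi (v, o1)) + F (phi (v, o2))).
Proof.
have [phi_bij phi_foot _ _ _] := phiP.
rewrite big_mkcond (big_corners _ _ phi_bij) (bigD1 v) //= !phi_foot eqxx big1 ?addr0 //.
by move=> w /negbTE wv; rewrite !phi_foot wv !addr0.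
Qed.

(** The potential of each of the two bits of the flow. *)
Lemma klein_potential (z : dartD -> bool * bool) : klein_flow z ->
  exists g : dartD -> bool * bool,
    (forall d, g (next_dart S (arcD d)) = g d) /\
    (forall d, z d = kadd (g d) (g (arcD d))).
Proof.
case/and4P=> /forallP z_arc _ z1 z2.
have orbit_sum (u : dartD -> bool) : balanced u ->
    forall d, \sum_(y | fconnect (next_dart S) d y) u y = 0.
  case/andP=> /forallP uv /forallP uc [h|[c i]].
    under eq_bigl => y do rewrite fconnect_next_dart.
    rewrite big_sumType /= [X in _ + X]big1 ?addr0 => [|[c i]] //.
    by rewrite -[RHS](eqP (uv (foot h))); apply: eq_bigl => h'; rewrite eq_sym.
  under eq_bigl => y do rewrite fconnect_next_dart.
  rewrite big_sumType /= big_pred0 ?add0r //.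
  rewrite (eq_bigl (fun p => (p.1 == c) && true)) => [|[c' j]] /=; last first.
    by rewrite eq_sym andbT.
  rewrite (eq_bigr (fun p => u (inr (p.1, p.2)))) => [|[c' j] _] //.
  rewrite -(pair_big (fun c' => c' == c) xpredT (fun c' j => u (inr (c', j)))) /=.
  by rewrite big_pred1_eq (eqP (uc c)).
have potential u := face_potential (@next_dart_inj _ _ S) (@arcK _ _ D)
  (@arc_neq _ _ D) (@arc_planar _ _ D) (x := u).
have [d|d|G1 [G1f G1z]] := potential (fun d => (z d).1).
- by rewrite (eqP (z_arc d)).
- exact: orbit_sum.
have [d|d|G2 [G2f G2z]] := potential (fun d => (z d).2).
- by rewrite (eqP (z_arc d)).
- exact: orbit_sum.
exists (fun d => (G1 d, G2 d)); split=> d; first by rewrite G1f G2f.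
by rewrite [LHS]surjective_pairing G1z G2z.
Qed.

(** Fix a potential g, that is, a colouring of the faces of the projection by
    1, i, j, k.  The quaternions g(left)^-1 g(right) multiply to 1 around each
    node, which gives the sign of the node as a product of one sign per dart;
    the two darts of an arc contribute opposite signs. *)
Lemma klein_flow_sign (z : dartD -> bool * bool) : klein_flow z -> straight z ->
  \prod_c crossing_sign z c =
  (-1) ^+ (#|vertex G| + #|edge G|) * \prod_v vertex_sign phi z v.
Proof.
move=> zf; have [g [g_face zg]] := klein_potential zf.
have g_arc d : g (arcD d) = g (next_dart S d).
  by rewrite -[d in RHS](@arcK _ _ D) g_face.
have nz d : kadd (g d) (g (next_dart S d)) != (false, false).
  by have /and4P[_ /forallP/(_ d) + _ _] := zf; rewrite zg g_arc.
rewrite straightE => /forallP zs.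
pose sgn d := quaternion_sign (g d) (g (arcD d)).
have sgn_arc d : sgn (arcD d) = ~~ sgn d.
  by rewrite /sgn (@arcK _ _ D) quaternion_sign_swap // g_arc.
have total : \prod_d (-1) ^+ sgn d = (-1) ^+ #|edge G| :> int.
  have cardB : #|[set d | sgn d]| = (#|edge G| + 2 * #|crossing D|)%N.
    have := cardsC [set d | sgn d].
    have -> : ~: [set d | sgn d] = [set arcD d | d in [set d | sgn d]].
      apply/setP => d; rewrite !inE; apply/idP/imsetP => [nd | [d' + ->]].
        by exists (arcD d); rewrite ?(@arcK _ _ D) // inE sgn_arc.
      by rewrite inE sgn_arc => ->.
    rewrite card_imset; last exact: can_inj (@arcK _ _ D).
    rewrite card_sum !card_prod card_bool card_ord.
    rewrite -[(Zp_trunc 4).+2]/4%N; lia.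
  rewrite prodrXr (_ : (\sum_d sgn d)%N = #|[set d | sgn d]|).
    by rewrite cardB exprD exprM expr2 mulrNN mulr1 expr1n mulr1.
  by rewrite -sum1_card [RHS]big_mkcond; apply: eq_bigr => d _; rewrite inE; case: (sgn d).
have [phi_bij _ rot0 rot1 rot2] := phiP.
have at_vertex v : (-1) ^+ sgn (inl (phi (v, o0))) *
   ((-1) ^+ sgn (inl (phi (v, o1))) * (-1) ^+ sgn (inl (phi (v, o2))))
   = - vertex_sign phi z v :> int.
  rewrite /sgn /vertex_sign !zg !g_arc /= rot0 rot1 rot2.
  have := nz (inl (phi (v, o0))); have := nz (inl (phi (v, o1))).
  have := nz (inl (phi (v, o2))); rewrite /= rot0 rot1 rot2 => n2 n1 n0.
  exact: quaternion_triangle.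
have at_crossing c : \prod_i (-1) ^+ sgn (inr (c, i)) = crossing_sign z c.
  rewrite big_Z4 /= /sgn /crossing_sign.
  have /andP[/eqP + /eqP] := zs c.
  have := nz (inr (c, 0)); have := nz (inr (c, 1)).
  rewrite !zg !g_arc /=.
  have Z4 : (0 + 1 = 1 :> 'Z_4) * (1 + 1 = 2%:R :> 'Z_4) * (2%:R + 1 = 3%:R :> 'Z_4)
    * (3%:R + 1 = 0 :> 'Z_4) by do !split; apply: val_inj.
  rewrite !Z4 => n1 n0 e2 e3.
  by apply: quaternion_square => //; rewrite ?e2 ?e3.
have := total; rewrite big_sumType /= (big_corners _ _ phi_bij).
rewrite (eq_bigr _ (fun v _ => at_vertex v)).
rewrite [X in _ * X](_ : _ = \prod_c crossing_sign z c); last first.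
  rewrite (eq_bigr (fun p => (-1) ^+ sgn (inr (p.1, p.2)))) => [|[c i] _] //.
  rewrite -(pair_bigA _ (fun c i => (-1) ^+ sgn (inr (c, i)))) /=.
  exact: eq_bigr.
rewrite prodrN => totalE.
have sq : \prod_c crossing_sign z c * \prod_c crossing_sign z c = 1.
  by rewrite -big_split big1 // => c _; rewrite /crossing_sign; case: ifP.
have sgnV n : (-1) ^+ n * (-1) ^+ n = 1 :> int.
  by rewrite -expr2 sqrr_sign.
rewrite exprD -[RHS]mulr1 -[X in _ = _ * X]sq.
move: totalE (sgnV #|edge G|); move: (\prod_c _) (\prod_v _) ((-1) ^+ #|edge G|).
move: ((-1) ^+ _) => a y x b axy bb.
transitivity (b * (a * y * x) * x); last by ring.
by rewrite axy bb mul1r.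
Qed.

(** Going straight through the crossings, the strand of a dart contains the two
    halves of an edge e.  By other_end it has no other end, hence e is unique. *)
Lemma edge_of_dart : exists eo : dartD -> edge G,
  [/\ forall e b, eo (inl (e, b)) = e, forall d, eo (arcD d) = eo d,
      forall d, eo (acrossD d) = eo d
    & forall d, connect (link arcD acrossD) (inl (eo d, false)) d].
Proof.
have acrossK : involutive acrossD.
  case=> [h|[c i]] //=; rewrite -addrA (_ : 2%:R + 2%:R = 0) ?addr0 //.
  exact: val_inj.
have symL := link_sym (@arcK _ _ D) acrossK.
have ex d : exists e, connect (link arcD acrossD) (inl (e, false)) d.
  have [[e []] eP] := strand_cover d; exists e => //.
  exact: connect_trans (strand_edge D e) eP.
have [eo eoP] := fin_all_exists ex.
have uniq_e e b e' : connect (link arcD acrossD) (inl (e, false)) (inl (e', b)) ->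
    e' = e.
  move=> ee'.
  have [d' _ only] := other_end (@arcK _ _ D) acrossK (@arc_neq _ _ D)
    (erefl : acrossD (inl (e, false)) = _).
  case: (only _ (strand_edge D e) erefl) => // d'E.
  by case: (only _ ee' erefl) => [[->]|] //; rewrite -d'E => -[->].
have eo_eq d d' : connect (link arcD acrossD) d d' -> eo d = eo d'.
  move=> dd'; apply: (@uniq_e _ false).
  by rewrite (connect_trans (eoP d')) // symL (connect_trans (eoP d)).
exists eo; split=> // [e b|d|d].
- exact/esym/(uniq_e _ b)/eoP.
- by apply: eo_eq; rewrite symL connect1 // /link eqxx.
by apply: eo_eq; rewrite symL connect1 // /link eqxx orbT.
Qed.

(** The signs of crossings in yamada_straight become signs of vertices by
    klein_flow_sign, and the two powers of -1 cancel.  A straight function is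
    constant along the edges of G, that is, an edge colouring; if it is not a
    flow, then some vertex has two half-edges of the same colour and its sign is
    0. *)
Lemma yamada_penrose :
  yamada D (1 : int) = \sum_(c : {ffun edge G -> 'I_3}) \prod_v
    levi_civita (c (phi (v, o0)).1) (c (phi (v, o1)).1) (c (phi (v, o2)).1).
Proof.
have [eo [eo_h eo_arc eo_across eo_con]] := edge_of_dart.
rewrite yamada_straight big_distrr /=.
transitivity (\sum_(z : {ffun dartD -> bool * bool} |
    [&& [forall d, z (arcD d) == z d], [forall d, z d != (false, false)]
      & straight z]) \prod_v vertex_sign phi z v).
  rewrite big_mkcond [RHS]big_mkcond; apply: eq_bigr => z _ /=.
  case: ifP => [/andP[zf zs] | zf].
    rewrite klein_flow_sign // mulrA -expr2 sqrr_sign mul1r.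
    by have /and4P[-> -> _ _] := zf; rewrite zs.
  case: ifP => // /and3P[za znz zs].
  move: zf; rewrite zs andbT /klein_flow za znz /= => zb.
  have crossing_balanced (pr : bool * bool -> bool) c :
      \sum_i pr (z (inr (c, i))) = 0.
    move: zs; rewrite straightE => /forallP/(_ c)/andP[/eqP z2 /eqP z3].
    by rewrite big_Z4 z2 z3; case: (pr _); case: (pr _).
  have : ~~ [forall v, (\sum_(h | foot h == v) (z (inl h)).1 == 0)
                    && (\sum_(h | foot h == v) (z (inl h)).2 == 0)].
    apply: contraFN zb => /forallP vb.
    rewrite /balanced; apply/andP; split; apply/andP; split; apply/forallP => w.
    - by case/andP: (vb w).
    - by rewrite (crossing_balanced fst).
    - by case/andP: (vb w).
    by rewrite (crossing_balanced snd).
  rewrite negb_forall => /existsP[v]; rewrite !sum_at_vertex => vb.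
  rewrite (bigD1 v) //= [X in X * _](_ : _ = 0) ?mul0r //; move: vb.
  rewrite /vertex_sign; case: (z _) => [[] []]; case: (z _) => [[] []];
  by case: (z _) => [[] []].
rewrite (reindex_onto (fun c : {ffun edge G -> 'I_3} => [ffun d => of_color (c (eo d))])
  (fun z : {ffun dartD -> bool * bool} => [ffun e => to_color (z (inl (e, false)))])) /=.
  apply: eq_big => [c | c _].
    apply/andP; split; last first.
      by apply/eqP/ffunP => e; rewrite !ffunE eo_h of_colorK.
    apply/and3P; split; apply/forallP => d; rewrite !ffunE ?eo_arc ?eo_across //.
    by case: (c _) => [[|[|[|]]] ?].
  apply: eq_bigr => v _; rewrite /vertex_sign !ffunE !klein_index_color.
  by case: (phi (v, o0)) (phi (v, o1)) (phi (v, o2)) => [e0 b0] [e1 b1] [e2 b2];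
    rewrite !eo_h.
move=> z /and3P[/forallP za /forallP znz /forallP zs].
apply/ffunP => d; rewrite !ffunE to_colorK //.
by apply: connect_link_invariant (eo_con d) => d'; apply/eqP.
Qed.

End PenroseSum.

(** * Tensor networks on cubic graphs *)

Section Contraction.

Variables (V E : finType) (phi : V * 'I_3 -> E * bool).
Hypothesis phi_bij : bijective phi.

(** The value of the tensor network on the cubic graph with half-edges E * bool,
    where phi labels the half-edges around each vertex, with the tensor K e on
    the edge e and the tensor W at each vertex. *)
Definition contraction (R : comPzRingType) (T : finType)
    (K : E -> T -> T -> R) (W : T -> T -> T -> R) : R :=
  \sum_(c : {ffun E * bool -> T})
    (\prod_e K e (c (e, false)) (c (e, true))) *
    \prod_v W (c (phi (v, o0))) (c (phi (v, o1))) (c (phi (v, o2))).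

Lemma big_edge_ends (R : Type) (idx : R) (op : Monoid.com_law idx)
    (F : E * bool -> R) :
  \big[op/idx]_h F h = \big[op/idx]_e op (F (e, false)) (F (e, true)).
Proof.
rewrite (eq_bigr (fun p => F (p.1, p.2))) => [|[v k] _] //.
rewrite -(pair_bigA _ (fun e b => F (e, b))) /=.
by apply: eq_bigr => e _; rewrite big_bool Monoid.mulmC.
Qed.

Variable R : comPzRingType.

Lemma prod_edge_sum (A : finType) (f : E -> A -> A -> R) :
  \prod_e \sum_a \sum_b f e a b =
  \sum_(c : {ffun E * bool -> A}) \prod_e f e (c (e, false)) (c (e, true)).
Proof.
under eq_bigr => e _ do rewrite (pair_bigA _ (f e)) /=.
rewrite bigA_distr_bigA /=.
rewrite (reindex (fun c : {ffun E * bool -> A} =>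
  [ffun e => (c (e, false), c (e, true))])) /=.
  by apply: eq_bigr => c _; apply: eq_bigr => e _; rewrite ffunE.
exists (fun g : {ffun E -> A * A} =>
  [ffun h => if h.2 then (g h.1).2 else (g h.1).1]) => [c _ | g _].
  by apply/ffunP => -[e []]; rewrite !ffunE.
by apply/ffunP => e; rewrite !ffunE -surjective_pairing.
Qed.

Lemma prod_corner_sum (A : finType) (f : V -> A -> A -> A -> R) :
  \prod_v \sum_a \sum_b \sum_c f v a b c =
  \sum_(c : {ffun E * bool -> A})
    \prod_v f v (c (phi (v, o0))) (c (phi (v, o1))) (c (phi (v, o2))).
Proof.
have [psi phiK psiK] := phi_bij.
rewrite (eq_bigr (fun v => \sum_(p : A * (A * A)) f v p.1 p.2.1 p.2.2)); last first.
  move=> v _; under eq_bigr => a _ do rewrite (pair_bigA _ (f v a)) /=.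
  by rewrite (pair_bigA _ (fun a p => f v a p.1 p.2)).
rewrite bigA_distr_bigA /=.
rewrite (reindex (fun c : {ffun E * bool -> A} =>
  [ffun v => (c (phi (v, o0)), (c (phi (v, o1)), c (phi (v, o2))))])) /=.
  by apply: eq_bigr => c _; apply: eq_bigr => e _; rewrite ffunE.
exists (fun g : {ffun V -> A * (A * A)} =>
  [ffun h => let: (v, k) := psi h in
    match val k with 0 => (g v).1 | 1 => (g v).2.1 | _ => (g v).2.2 end])
  => [c _ | g _].
  apply/ffunP => h; rewrite !ffunE -{2}(psiK h); case: (psi h) => v [[|[|[|]]] k3] //=;
    rewrite ffunE /=; congr (c (phi (_, _))); exact: val_inj.
by apply/ffunP => v; rewrite !ffunE !phiK /=; case: (g v) => a [].
Qed.

(** Change of basis: if the edge tensors factor through vectors X a, these can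
    be contracted with the vertex tensors instead. *)
Lemma contraction_basis (T A : finType) (K : E -> T -> T -> R)
    (W : T -> T -> T -> R) (om : A -> A -> R) (X : A -> T -> R)
    (U : A -> A -> A -> R) :
    (forall e x y, K e x y = \sum_a \sum_b om a b * (X a x * X b y)) ->
    (forall a b c, U a b c =
       \sum_x \sum_y \sum_z W x y z * (X a x * (X b y * X c z))) ->
  contraction K W = contraction (fun=> om) U.
Proof.
move=> KE UE; rewrite /contraction.
transitivity (\sum_(c : {ffun E * bool -> T}) \sum_(a : {ffun E * bool -> A})
  (\prod_e om (a (e, false)) (a (e, true))) *
  \prod_v (W (c (phi (v, o0))) (c (phi (v, o1))) (c (phi (v, o2))) *
    (X (a (phi (v, o0))) (c (phi (v, o0))) *
      (X (a (phi (v, o1))) (c (phi (v, o1))) *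
       X (a (phi (v, o2))) (c (phi (v, o2))))))).
  apply: eq_bigr => c _; under eq_bigr => e _ do rewrite KE.
  rewrite (prod_edge_sum (fun e a b =>
    om a b * (X a (c (e, false)) * X b (c (e, true))))) big_distrl /=.
  apply: eq_bigr => a _; rewrite !big_split /= -!mulrA; congr (_ * _).
  rewrite mulrA -!big_split /= -(big_edge_ends _ (fun h => X (a h) (c h))).
  rewrite (big_corners _ _ phi_bij) /= mulrC -big_split /=.
  by apply: eq_bigr.
rewrite exchange_big; apply: eq_bigr => a _ /=; rewrite -big_distrr /=.
congr (_ * _); under [RHS]eq_bigr => v _ do rewrite UE.
by rewrite (prod_corner_sum (fun v x y z => W x y z *
  (X (a (phi (v, o0))) x * (X (a (phi (v, o1))) y * X (a (phi (v, o2))) z)))).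
Qed.

Lemma contraction_sum (T I : finType) (K : E -> I -> T -> T -> R)
    (W : T -> T -> T -> R) :
  contraction (fun e x y => \sum_i K e i x y) W =
  \sum_(J : {ffun E -> I}) contraction (fun e => K e (J e)) W.
Proof.
rewrite exchange_big; apply: eq_bigr => c _.
by rewrite bigA_distr_bigA big_distrl.
Qed.

Lemma contraction_scale_edge (T : finType) (K : E -> T -> T -> R) W (w : E -> R) :
  contraction (fun e x y => w e * K e x y) W = (\prod_e w e) * contraction K W.
Proof.
by rewrite big_distrr; apply: eq_bigr => c _; rewrite big_split /= mulrA.
Qed.

Lemma contraction_scale_vertex (T : finType) (K : E -> T -> T -> R) W k :
  contraction K (fun x y z => k * W x y z) = k ^+ #|V| * contraction K W.
Proof.
rewrite big_distrr; apply: eq_bigr => c _.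
by rewrite big_split prodr_const /= mulrCA.
Qed.

Lemma eq_contraction (T : finType) (K K' : E -> T -> T -> R) W W' :
    (forall e x y, K e x y = K' e x y) ->
    (forall x y z, W x y z = W' x y z) ->
  contraction K W = contraction K' W'.
Proof.
move=> KK WW; apply: eq_bigr => c _.
by congr (_ * _); apply: eq_bigr => ? _; rewrite ?KK ?WW.
Qed.

(** Conservation of weight: the edges preserve total weight zero, hence a
    vertex tensor without entries of negative weight only contributes through
    its entries of weight zero. *)
Lemma contraction_weight (A : finType) (om : A -> A -> R) (wt : A -> int)
    (U U' : A -> A -> A -> R) :
    (forall a b, wt a + wt b != 0 -> om a b = 0) ->
    (forall a b c, wt a + (wt b + wt c) < 0 -> U a b c = 0 /\ U' a b c = 0) ->
    (forall a b c, wt a + (wt b + wt c) = 0 -> U a b c = U' a b c) ->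
  contraction (fun=> om) U = contraction (fun=> om) U'.
Proof.
move=> om0 neg zero; apply: eq_bigr => a _.
have [/forallP edge0 | ] :=
    boolP [forall e, wt (a (e, false)) + wt (a (e, true)) == 0]; last first.
  rewrite negb_forall => /existsP[e ne0].
  by rewrite (bigD1 e) //= om0 // !mul0r.
congr (_ * _); pose w v := wt (a (phi (v, o0))) + (wt (a (phi (v, o1))) +
  wt (a (phi (v, o2)))).
have total : \sum_v w v = 0.
  rewrite -(big_corners _ (fun h => wt (a h)) phi_bij) big_edge_ends big1 // => e _.
  exact/eqP/edge0.
have [/existsP[v wv] | ] := boolP [exists v, w v < 0].
  by have [U0 U0'] := neg _ _ _ wv; rewrite (bigD1 v) // [RHS](bigD1 v) //= U0 U0' !mul0r.
rewrite negb_exists => /forallP pos.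
apply: eq_bigr => v _; apply: zero; apply/eqP; move: total.
move/eqP; rewrite psumr_eq0 => [|u _]; last by rewrite leNgt.
by move/allP/(_ v); rewrite mem_index_enum => /(_ isT).
Qed.

End Contraction.

(** * The negligible combination of pairings modulo 5 *)

(* the three perfect matchings of a square of points *)
Definition matching (t : 'I_3) (x : bool * bool) : bool * bool :=
  match val t with
  | 0 => (~~ x.1, x.2)
  | 1 => (~~ x.1, ~~ x.2)
  | _ => (x.1, ~~ x.2)
  end%N.

Lemma matching_neq t x : matching t x != x.
Proof. by case: t => [[|[|[|]]] ?]; case: x => [[] []]. Qed.

Lemma matchingK t : involutive (matching t).
Proof. by case: t => [[|[|[|]]] ?]; case=> [[] []]. Qed.

Lemma matching_cover (x y : bool * bool) : x != y -> exists t, y = matching t x.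
Proof.
by case: x => [[] []]; case: y => [[] []] // _;
  first [by exists o0 | by exists o1 | by exists o2].
Qed.

Lemma matching_involution (p : bool * bool -> bool * bool) :
  (forall x, p x != x) -> involutive p -> exists t, p =1 matching t.
Proof.
move=> p_neq pK; have [|t tE] := @matching_cover (false, false) (p (false, false)).
  by rewrite eq_sym.
exists t => x; have pI := can_inj pK.
have [-> // | x0] := eqVneq x (false, false).
have [-> | x1] := eqVneq x (p (false, false)); first by rewrite pK tE matchingK.
have y0 : p x != (false, false) by rewrite -(inj_eq pI) pK.
have y1 : p x != p (false, false) by rewrite (inj_eq pI).
have yx := p_neq x; move: x0 x1 y0 y1 yx; rewrite !tE.
by case: t {tE} => [[|[|[|]]] ?]; case: x => [[] []] //; case: (p _) => [[] []].
Qed.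

Section FourPoints.

Variables (Y : finType) (nu mu : Y -> Y) (pt : bool * bool -> Y).
Hypotheses (nuK : involutive nu) (muK : involutive mu).
Hypothesis nu_neq : forall y, nu y != y.
Hypothesis pt_inj : injective pt.
Hypothesis mu_fixed : forall y, mu y = y <-> exists x, y = pt x.

Notation coloring := {ffun Y -> 'I_3}.
Notation L := (link nu mu).

Definition invariant_coloring (c : coloring) : bool :=
  [forall y, (c (nu y) == c y) && (c (mu y) == c y)].

Definition matched (t : 'I_3) (c : coloring) : bool :=
  [forall x, c (pt (matching t x)) == c (pt x)].

(** Adding a constant on the component of d permutes the invariant colourings
    and shifts the difference of the colours of r and d. *)
Lemma equidistributed d r : ~~ connect L d r ->
  (3 * #|[set c : coloring | invariant_coloring c && (c r == c d)]|)%N =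
  #|[set c : coloring | invariant_coloring c]|.
Proof.
move=> ndr; have symL := link_sym nuK muK.
have shift_card j : #|[set c : coloring | invariant_coloring c && (c r == c d + j)]| =
    #|[set c : coloring | invariant_coloring c && (c r == c d)]|.
  pose shift (j : 'I_3) (c : coloring) : coloring :=
    [ffun y => if connect L d y then c y + j else c y].
  have shift_inv i c : invariant_coloring c -> invariant_coloring (shift i c).
    move/forallP=> ci; apply/forallP => y; rewrite !ffunE.
    rewrite -(same_connect_r symL (connect1 (_ : L y (nu y)))); last first.
      by rewrite /link eqxx.
    rewrite -(same_connect_r symL (connect1 (_ : L y (mu y)))); last first.
      by rewrite /link eqxx orbT.
    by have /andP[/eqP-> /eqP->] := ci y; rewrite !eqxx.
  apply: (@card_bij_on _ _ _
    (fun c : coloring => invariant_coloring c && (c r == c d))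
    (shift j) (shift (- j))) => c /andP[ci /eqP cr].
    split; first by rewrite shift_inv //= !ffunE connect0 (negbTE ndr) cr eqxx.
    by apply/ffunP => y; rewrite !ffunE; case: (connect _ _ _); rewrite ?addrK.
  split; first by rewrite shift_inv //= !ffunE connect0 (negbTE ndr) cr subrK eqxx.
  by apply/ffunP => y; rewrite !ffunE; case: (connect _ _ _); rewrite ?subrK.
rewrite -[RHS]sum1_card (partition_big (fun c : coloring => c r - c d) predT) //=.
rewrite (eq_bigr (fun=> #|[set c : coloring | invariant_coloring c && (c r == c d)]|)).
  by rewrite sum_nat_const card_ord.
move=> j _; rewrite -(shift_card j) -sum1_card; apply: eq_bigl => c.
by rewrite !inE subr_eq addrC.
Qed.

(** Outside the four points, nu and mu join these points in pairs.  If they are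
    matched accordingly, every invariant colouring is compatible; each of the
    two other matchings identifies the colours of two components, which
    divides the number of colourings by 3.  The total is thus
    (1 + 1/3 + 1/3) = 5/3 of a multiple of 3. *)
Lemma matchings_sum : exists m,
  (\sum_t #|[set c : coloring | invariant_coloring c && matched t c]|)%N = (5 * m)%N.
Proof.
have symL := link_sym nuK muK.
have partner_ex x : exists x', [/\ x' != x, connect L (pt x) (pt x') &
    forall x'', connect L (pt x) (pt x'') -> x'' = x \/ x'' = x'].
  have mux : mu (pt x) = pt x by apply/mu_fixed; exists x.
  have [d' [d'x mud' cd'] only] := other_end nuK muK nu_neq mux.
  have [x' x'E] := (mu_fixed d').1 mud'; exists x'; rewrite -x'E; split=> //.
    by apply: contraNneq d'x => <-; rewrite x'E.
  move=> x'' cx''; have [|/pt_inj|] := only _ cx''; last by rewrite x'E => /pt_inj; right.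
    by apply/mu_fixed; exists x''.
  by left.
have [p pP] := fin_all_exists partner_ex.
have p_neq x : p x != x by have [] := pP x.
have p_con x : connect L (pt x) (pt (p x)) by have [] := pP x.
have pK : involutive p.
  move=> x; have [_ _ only] := pP (p x).
  case: (only x); rewrite 1?symL ?p_con // => xE.
  by have := p_neq x; rewrite -xE eqxx.
have [t0 t0P] := matching_involution p_neq pK.
have inv_con (c : coloring) y y' : invariant_coloring c -> connect L y y' -> c y = c y'.
  move/forallP=> ci; apply: connect_link_invariant => z.
    by have /andP[/eqP] := ci z.
  by have /andP[_ /eqP] := ci z.
have card_t0 : #|[set c : coloring | invariant_coloring c && matched t0 c]| =
    #|[set c : coloring | invariant_coloring c]|.
  apply: eq_card => c; rewrite !inE; apply: andb_idr => ci.
  by apply/forallP => x; rewrite -t0P eq_sym (inv_con _ _ _ ci (p_con x)).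
have card_t t : t != t0 ->
    (3 * #|[set c : coloring | invariant_coloring c && matched t c]|)%N =
    #|[set c : coloring | invariant_coloring c]|.
  move=> tt0; pose x0 := (false, false).
  rewrite -(@equidistributed (pt x0) (pt (matching t x0))); last first.
    apply/negP => /(let: And3 _ _ only := pP x0 in only) [] /eqP.
      by rewrite (negbTE (matching_neq _ _)).
    rewrite t0P; move: tt0; rewrite /x0 -val_eqE.
    by case: t => [[|[|[|]]] ?]; case: (t0) => [[|[|[|]]] ?].
  congr (3 * _)%N; apply: eq_card => c; rewrite !inE.
  apply: andb_id2l => ci; apply/forallP/idP => [/(_ x0) // | /eqP c0 x].
  have cp y : c (pt (matching t0 y)) = c (pt y).
    by rewrite -t0P (inv_con _ _ _ ci (p_con y)).
  have := cp x0; have := cp (matching t x0).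
  move: c0 tt0; rewrite /x0 -val_eqE.
  by case: t => [[|[|[|]]] ?]; case: (t0) => [[|[|[|]]] ?] //;
    case: x => [[] []]; rewrite /matching /= => -> // _ -> ->.
have [t1 [t2 [t10 t20 t12]]] : exists t1 t2, [/\ t1 != t0, t2 != t0 & t1 != t2].
  case: (t0) => [[|[|[|]]] ?] //; [exists o1, o2 | exists o0, o2 | exists o0, o1];
    by split.
exists #|[set c : coloring | invariant_coloring c && matched t1 c]|.
rewrite (bigD1 t0) //= (bigD1 t1) ?t10 //= (bigD1 t2) /=; last by rewrite t20 eq_sym.
rewrite big1 => [|t /andP[/andP[n0 n1] n2]]; last first.
  by move: n0 n1 n2 t10 t20 t12; rewrite -!val_eqE; case: t => [[|[|[|]]] ?];
    case: (t0) => [[|[|[|]]] ?]; case: (t1) => [[|[|[|]]] ?];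
    case: (t2) => [[|[|[|]]] ?].
have := card_t _ t10; have := card_t _ t20; rewrite -card_t0.
set n0 := #|_|; set n1 := #|_|; set n2 := #|_| => e2 e1.
by rewrite -[LHS]/(n1 + (n2 + (n0 + 0)))%N; lia.
Qed.

End FourPoints.

Lemma all_iota n (P : pred nat) : all P (iota 0 n) -> forall i : 'I_n, P i.
Proof. by move=> /allP Pn i; apply: Pn; rewrite mem_iota ltn_ord. Qed.

Definition select (T : Type) (x0 x1 x2 : T) (k : nat) : T :=
  match k with 0%N => x0 | 1%N => x1 | _ => x2 end.

(** The product of two determinants, as the determinant of the matrix of
    Kronecker deltas. *)
Lemma levi_civita_mul (i0 i1 i2 j0 j1 j2 : 'I_3) :
  levi_civita i0 i1 i2 * levi_civita j0 j1 j2 =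
  \sum_(a < 3) \sum_(b < 3) \sum_(c < 3) levi_civita a b c *
    [&& i0 == select j0 j1 j2 a, i1 == select j0 j1 j2 b
      & i2 == select j0 j1 j2 c]%:R.
Proof.
pose sum3 F : int := F 0%N + (F 1%N + F 2%N).
pose test (i0 i1 i2 j0 j1 j2 : nat) := levi_civita i0 i1 i2 * levi_civita j0 j1 j2 ==
  sum3 (fun a => sum3 (fun b => sum3 (fun c => levi_civita a b c *
    [&& i0 == select j0 j1 j2 a, i1 == select j0 j1 j2 b
      & i2 == select j0 j1 j2 c]%:R))).
have tests : all (fun i0 => all (fun i1 => all (fun i2 => all (fun j0 =>
    all (fun j1 => all (test i0 i1 i2 j0 j1) (iota 0 3)) (iota 0 3))
    (iota 0 3)) (iota 0 3)) (iota 0 3)) (iota 0 3) by vm_compute.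
move: tests => /all_iota/(_ i0)/all_iota/(_ i1)/all_iota/(_ i2).
move=> /all_iota/(_ j0)/all_iota/(_ j1)/all_iota/(_ j2)/eqP ->.
by rewrite /sum3 !big_I3 /= -!val_eqE.
Qed.

Definition color_pair : finType := ('I_3 * 'I_3)%type.

Definition pairing (t : 'I_3) (x y : color_pair) : bool :=
  match val t with
  | 0%N => (x.1 == y.1) && (x.2 == y.2)
  | 1%N => (x.1 == y.2) && (x.2 == y.1)
  | _ => (x.1 == x.2) && (y.1 == y.2)
  end.

Definition levi_civita2 (x y z : color_pair) : int :=
  levi_civita x.1 y.1 z.1 * levi_civita x.2 y.2 z.2.

Lemma forall_bool2 (P : pred (bool * bool)) :
  [forall x, P x] = [&& P (false, false), P (false, true), P (true, false) & P (true, true)].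
Proof.
apply/forallP/and4P => [PP | [? ? ? ?] [[] []] //].
by split.
Qed.

Section Negligible.

Variables (V E : finType) (phi : V * 'I_3 -> E * bool).
Hypothesis phi_bij : bijective phi.

Notation point := (E * bool * bool)%type.

Definition colored_points (c : E * bool -> color_pair) : {ffun point -> 'I_3} :=
  [ffun p => if p.2 then (c p.1).2 else (c p.1).1].

Definition edge_point (e : E) (x : bool * bool) : point := ((e, x.1), x.2).

Lemma pairing_matching t (c : E * bool -> color_pair) e :
  pairing t (c (e, false)) (c (e, true)) =
  [forall x, colored_points c (edge_point e (matching t x))
               == colored_points c (edge_point e x)].
Proof.
rewrite forall_bool2; case: t => [[|[|[|]]] t3] //;
  rewrite /pairing /matching /= !ffunE /=;
  case: (c (e, false)) (c (e, true)) => [x1 x2] [y1 y2] /=;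
  apply/andP/and4P => [[/eqP-> /eqP->] | [/eqP e1 /eqP e2 /eqP e3 _]];
  by rewrite ?e1 ?e2 ?e3 ?eqxx.
Qed.

Definition corner_at (psi : E * bool -> V * 'I_3) (s : E * bool -> 'I_3) h :=
  phi ((psi h).1, s h).

(** Expanding the product of the two Levi-Civita symbols at each vertex, where s
    collects the permutations of the labels, leaves Kronecker deltas between
    the first colour of h and the second colour of corner_at psi s h. *)
Lemma prod_levi_civita2 (psi : E * bool -> V * 'I_3) (c : {ffun E * bool -> color_pair}) :
    cancel phi psi -> cancel psi phi ->
  \prod_v levi_civita2 (c (phi (v, o0))) (c (phi (v, o1))) (c (phi (v, o2))) =
  \sum_(s : {ffun E * bool -> 'I_3})
    (\prod_v levi_civita (s (phi (v, o0))) (s (phi (v, o1))) (s (phi (v, o2)))) *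
    [forall h, (c h).1 == (c (corner_at psi s h)).2]%:R.
Proof.
move=> phiK psiK.
under eq_bigr => v _ do rewrite /levi_civita2 levi_civita_mul.
pose second v := select (c (phi (v, o0))).2 (c (phi (v, o1))).2 (c (phi (v, o2))).2.
rewrite (prod_corner_sum phi_bij (fun v (i j k : 'I_3) => levi_civita i j k *
  [&& (c (phi (v, o0))).1 == second v i, (c (phi (v, o1))).1 == second v j
    & (c (phi (v, o2))).1 == second v k]%:R)) /second.
apply: eq_bigr => s _; rewrite big_split /=; congr (_ * _).
have selE v (k : 'I_3) : select (c (phi (v, o0))).2 (c (phi (v, o1))).2
    (c (phi (v, o2))).2 k = (c (phi (v, k))).2.
  by case: k => [[|[|[|]]] k3] //=; congr (c (phi (v, _))).2; apply: val_inj.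
under eq_bigr => v _ do rewrite !selE.
case: (boolP [forall h, _]) => [/forallP ch | ].
  apply: big1 => v _; have chv k :
      (c (phi (v, k))).1 == (c (phi (v, s (phi (v, k))))).2.
    by have := ch (phi (v, k)); rewrite /corner_at phiK.
  by rewrite !chv.
rewrite negb_forall => /existsP[h]; rewrite -(psiK h); case: (psi h) => v k.
rewrite /corner_at phiK /= => /negbTE chf; rewrite (bigD1 v) //=.
rewrite [[&& _, _ & _]](_ : _ = false) ?mul0r //.
by move: chf; case: k => [[|[|[|]]] k3] //=; rewrite (bool_irrelevance k3 isT) => ->;
  rewrite ?andbF.
Qed.

Lemma levi_civita_inj (g : 'I_3 -> 'I_3) :
  levi_civita (g o0) (g o1) (g o2) != 0 -> injective g.
Proof.
have gE k : g k = select (g o0) (g o1) (g o2) k.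
  by case: k => [[|[|[|]]] k3] //=; congr (g _); apply: val_inj.
move=> nz k k'; rewrite gE [g k']gE; move: nz.
case: (g o0) => [[|[|[|]]] ?] //; case: (g o1) => [[|[|[|]]] ?] //;
case: (g o2) => [[|[|[|]]] ?] //; case: k => [[|[|[|]]] ?] //;
by case: k' => [[|[|[|]]] ?] //= _ /(congr1 val) //= _; apply: val_inj.
Qed.

Variable psi : E * bool -> V * 'I_3.
Hypotheses (phiK : cancel phi psi) (psiK : cancel psi phi).

(** Once the vertices are expanded, the conditions on the colours are two
    matchings of the points (h, i), where i tells the first colour of h from the
    second one.  Only the four points on e0 are left free by the first
    matching, and matchings_sum applies. *)
Lemma card_pairings (s : E * bool -> 'I_3) (f : E -> 'I_3) (e0 : E) :
    \prod_v levi_civita (s (phi (v, o0))) (s (phi (v, o1))) (s (phi (v, o2))) != 0 ->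
  exists m, (\sum_t #|[set c : {ffun E * bool -> color_pair} |
     [forall e, pairing (if e == e0 then t else f e) (c (e, false)) (c (e, true))]
     && [forall h, (c h).1 == (c (corner_at psi s h)).2]]|)%N = (5 * m)%N.
Proof.
move=> /prodf_neq0 s_nz.
have tau_inj : injective (corner_at psi s).
  move=> h h'; rewrite -(psiK h) -(psiK h'); case: (psi h) (psi h') => v k [v' k'].
  rewrite /corner_at !phiK /= => /(can_inj phiK)/eqP.
  rewrite -[_ == _]/((v == v') && (s _ == s _)) => /andP[/eqP <- /eqP sk].
  have s_inj := @levi_civita_inj (fun k => s (phi (v, k))) (s_nz v isT).
  by rewrite (s_inj _ _ sk).
pose nu (p : point) : point := let: (h, i) := p in
  if i then (invF tau_inj h, false) else (corner_at psi s h, true).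
pose mu (p : point) : point := let: ((e, b), i) := p in
  if e == e0 then p else edge_point e (matching (f e) (b, i)).
have nuK : involutive nu by case=> h [] /=; rewrite ?invF_f ?f_invF.
have muE e x : mu (edge_point e x) =
    edge_point e (if e == e0 then x else matching (f e) x).
  by case: x => b i /=; case: (e == e0).
have pointE p : exists e x, p = edge_point e x.
  by case: p => [[e b] i]; exists e, (b, i).
have edge_point_inj e : injective (edge_point e) by move=> [b i] [b' i'] [-> ->].
have muK : involutive mu.
  move=> p; have [e [x ->]] := pointE p; rewrite !muE.
  by case: (e == e0); rewrite ?matchingK.
have nu_neq p : nu p != p.
  by case: p => h [] /=; rewrite -[_ == _]/((_ == _) && _) andbF.
have mu_fixed p : mu p = p <-> exists x, p = edge_point e0 x.
  split=> [|[x ->]]; last by rewrite muE eqxx.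
  have [e [x ->]] := pointE p; rewrite muE.
  case: (eqVneq e e0) => [-> _ | ne]; first by exists x.
  by move/edge_point_inj/eqP; rewrite (negbTE (matching_neq _ _)).
have [m mE] := matchings_sum nuK muK nu_neq (@edge_point_inj e0) mu_fixed.
exists m; rewrite -mE; apply: eq_bigr => t _.
have eqP_c (c : E * bool -> color_pair) :
    [forall e, pairing (if e == e0 then t else f e) (c (e, false)) (c (e, true))]
     && [forall h, (c h).1 == (c (corner_at psi s h)).2] =
    invariant_coloring nu mu (colored_points c)
      && matched (edge_point e0) t (colored_points c).
  apply/andP/andP => [[/forallP fit /forallP good] | [/forallP inv mat]].
    split; last by have := fit e0; rewrite eqxx pairing_matching.
    apply/forallP => -[h i]; apply/andP; split.
      rewrite !ffunE /=; case: i => /=; last by rewrite eq_sym.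
      by rewrite (eqP (good _)) f_invF.
    case: h => e b /=; case: ifP => [_|ne]; first exact: eqxx.
    by have := fit e; rewrite ne pairing_matching => /forallP/(_ (b, i)).
  split; [apply/forallP => e | apply/forallP => h].
    rewrite pairing_matching; case: (eqVneq e e0) => [-> // | ne].
    apply/forallP => -[b i]; have /andP[_] := inv ((e, b), i).
    by rewrite /= (negbTE ne).
  by have /andP[+ _] := inv (h, false); rewrite !ffunE eq_sym.
apply: (@card_bij_on _ _ _
  (fun y : {ffun point -> 'I_3} => invariant_coloring nu mu y && matched (edge_point e0) t y)
  (fun c : {ffun E * bool -> color_pair} => colored_points c)
  (fun y : {ffun point -> 'I_3} => [ffun h => (y (h, false), y (h, true))])).
  move=> c; rewrite eqP_c => ->; split=> //; apply/ffunP => h.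
  by rewrite !ffunE /= -surjective_pairing.
move=> y; rewrite eqP_c.
have -> : colored_points [ffun h => (y (h, false), y (h, true))] = y.
  by apply/ffunP => -[h []]; rewrite !ffunE.
by [].
Qed.

Lemma F5_nat5 m : (5 * m)%:R = 0 :> 'F_5.
Proof. by rewrite natrM (_ : 5%:R = 0 :> 'F_5) ?mul0r //; apply: val_inj. Qed.

Notation kernel := (E -> color_pair -> color_pair -> 'F_5).

Let epsilon2 (x y z : color_pair) : 'F_5 := (levi_civita2 x y z)%:~R.

Lemma pairings_sum0 (f : E -> 'I_3) e0 :
  \sum_t contraction phi
    (fun e x y => (pairing (if e == e0 then t else f e) x y)%:R) epsilon2 = 0.
Proof.
pose sgn (s : {ffun E * bool -> 'I_3}) :=
  \prod_v levi_civita (s (phi (v, o0))) (s (phi (v, o1))) (s (phi (v, o2))).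
transitivity (\sum_(s : {ffun E * bool -> 'I_3}) (sgn s)%:~R *
  (\sum_t #|[set c : {ffun E * bool -> color_pair} |
     [forall e, pairing (if e == e0 then t else f e) (c (e, false)) (c (e, true))]
     && [forall h, (c h).1 == (c (corner_at psi s h)).2]]|)%N%:R : 'F_5).
  under [RHS]eq_bigr => s _ do rewrite natr_sum big_distrr /=.
  rewrite [RHS]exchange_big; apply: eq_bigr => t _ /=.
  under [RHS]eq_bigr => s _ do rewrite -sum1_card natr_sum big_distrr /= big_mkcond.
  rewrite [RHS]exchange_big /contraction; apply: eq_bigr => c _ /=.
  have -> : \prod_v epsilon2 (c (phi (v, o0))) (c (phi (v, o1))) (c (phi (v, o2))) =
      (\prod_v levi_civita2 (c (phi (v, o0))) (c (phi (v, o1))) (c (phi (v, o2))))%:~R.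
    by rewrite rmorph_prod.
  rewrite (prod_levi_civita2 c phiK psiK) rmorph_sum big_distrr /=.
  apply: eq_bigr => s _; rewrite rmorphM /= -/(sgn s) inE.
  have -> : \prod_e (pairing (if e == e0 then t else f e) (c (e, false)) (c (e, true)))%:R
     = [forall e, pairing (if e == e0 then t else f e) (c (e, false)) (c (e, true))]%:R :> 'F_5.
    exact: prod_bool.
  by do 2![case: [forall _, _]]; rewrite /= ?mul0r ?mul1r ?mulr0 ?mulr1.
apply: big1 => s _; have [-> | /card_pairings cp] := eqVneq (sgn s) 0.
  by rewrite mul0r.
by have [m ->] := cp f e0; rewrite F5_nat5 mulr0.
Qed.

(** The sum of the three pairings is negligible modulo 5: closing it up in any
    way gives 3 ^ 2 + 3 + 3 = 15 times a power of 3.  In characteristic 5 it is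
    proportional to the projector of the square of the adjoint representation
    of SO(3) onto its summand of dimension 5. *)
Lemma negligible (K : kernel) (w : E -> 'I_3 -> 'F_5) e0 :
    (forall e x y, K e x y = \sum_t w e t * (pairing t x y)%:R) ->
    (forall t, w e0 t = 1) ->
  contraction phi K epsilon2 = 0.
Proof.
move=> KE w1; pose C (f : E -> 'I_3) :=
  contraction phi (fun e x y => (pairing (f e) x y)%:R) epsilon2.
have -> : contraction phi K epsilon2 =
    \sum_(f : {ffun E -> 'I_3}) (\prod_e w e (f e)) * C f.
  rewrite (@eq_contraction _ _ _ _ _ _ (fun e x y =>
    \sum_t w e t * (pairing t x y)%:R) _ epsilon2) // contraction_sum.
  by apply: eq_bigr => f _; rewrite -contraction_scale_edge.
pose turn j (f : {ffun E -> 'I_3}) := [ffun e => if e == e0 then f e + j else f e].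
have turnK j : cancel (turn j) (turn (- j)).
  by move=> f; apply/ffunP => e; rewrite !ffunE; case: (e == e0); rewrite ?addrK.
have weight_turn j f : \prod_e w e (turn j f e) = \prod_e w e (f e).
  by apply: eq_bigr => e _; rewrite ffunE; case: eqP => // ->; rewrite !w1.
set total := \sum_f _.
have totalE j : total = \sum_(f : {ffun E -> 'I_3}) (\prod_e w e (f e)) * C (turn j f).
  rewrite /total (reindex_inj (can_inj (turnK j))) /=.
  by apply: eq_bigr => f _; rewrite weight_turn.
(* Averaging over the three values of f at e0. *)
have : total *+ 3 = 0.
  transitivity (\sum_(j < 3) total); first by rewrite sumr_const card_ord.
  under eq_bigr => j _ do rewrite (totalE j).
  rewrite exchange_big big1 // => f _ /=; rewrite -big_distrr /=.
  rewrite [X in _ * X](_ : _ = 0) ?mulr0 // -[RHS](pairings_sum0 f e0).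
  rewrite [RHS](reindex_inj (addrI (f e0))) /=.
  apply: eq_bigr => j _; apply: eq_contraction => // e x y.
  by rewrite ffunE; case: eqP => // ->.
move/eqP; rewrite -mulr_natr mulf_eq0 => /orP[/eqP //|].
by [].
Qed.

End Negligible.

(** * The monomial and the so(3) networks *)

Lemma F5_intr (x y : int) : (x%:~R == y%:~R :> 'F_5) = (5 %| x - y)%Z.
Proof.
rewrite -subr_eq0 -rmorphB /= (dvdz_pcharf (pchar_Fp (isT : prime 5))).
by [].
Qed.

(** Sums over lists of natural numbers, which can be computed. *)
Definition zsum (n : nat) (F : nat -> int) : int :=
  foldr (fun i s => F i + s) 0 (iota 0 n).

Lemma sum_zsum n (F : nat -> int) :
  \sum_(i < n) (F i)%:~R = (zsum n F)%:~R :> 'F_5.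
Proof.
rewrite -rmorph_sum /=; congr (_%:~R).
rewrite -(big_mkord xpredT F) /zsum /index_iota subn0.
by elim: (iota 0 n) => [|i s IH]; rewrite ?big_nil ?big_cons //= IH.
Qed.

Lemma sum_zsum2 n (F : nat -> nat -> int) :
  \sum_(x : 'I_n * 'I_n) (F x.1 x.2)%:~R
    = (zsum n (fun i => zsum n (F i)))%:~R :> 'F_5.
Proof.
rewrite -(pair_bigA _ (fun (i j : 'I_n) => (F i j)%:~R)) /=.
under eq_bigr => i _ do rewrite (sum_zsum n (F i)).
by rewrite (sum_zsum n (fun i => zsum n (F i))).
Qed.

(** The edge tensor on four labels a, viewed as the exponents modulo 4 of the
    monomial functions x ^ a on the nonzero elements of the field with five
    elements. *)
Definition exponent_pairing (a b : nat) : int :=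
  if (4 %| a + b)%N then (if odd a then 1 else -1) else 0.

(** Paired exponents have opposite weights, and the nonzero entries of the vertex
    tensors have nonnegative total weight. *)
Definition exponent_weight (a : nat) : int :=
  match a with 1%N => -1 | 3%N => 1 | _ => 0 end.

Definition monomial (a n : nat) : int := if n == 0%N then 0 else (n ^ a)%N%:Z.

Definition monomial_sum (a b c : nat) : int :=
  zsum 5 (fun x => zsum 5 (fun y => zsum 5 (fun z =>
    (5 %| x + y + z)%N%:R * (monomial a x * (monomial b y * monomial c z))))).

(** Modulo 5, the matrices for a = 1, 2, 3 are a basis of so(3) in which the
    invariant form is the edge tensor on the exponents; the square root 2 of -1
    makes two of these matrices isotropic. *)
Definition so3_matrix (a i j : nat) : int :=
  match a with
  | 0%N => (i == j)%:R
  | 1%N => levi_civita i j 0 + 2 * levi_civita i j 1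
  | 2%N => 2 * levi_civita i j 2
  | _ => 3 * levi_civita i j 0 - levi_civita i j 1
  end.

Definition so3_sum (a b c : nat) : int :=
  zsum 3 (fun i0 => zsum 3 (fun j0 => zsum 3 (fun i1 => zsum 3 (fun j1 =>
  zsum 3 (fun i2 => zsum 3 (fun j2 =>
    levi_civita i0 i1 i2 * levi_civita j0 j1 j2 *
    (so3_matrix a i0 j0 * (so3_matrix b i1 j1 * so3_matrix c i2 j2)))))))).

(** Orthogonality of the characters x ^ a of the multiplicative group. *)
Lemma monomial_pairing (x y : 'F_5) :
  ((x != 0) && (x + y == 0))%:R = \sum_(a < 4) \sum_(b < 4)
    (exponent_pairing a b)%:~R * ((monomial a x)%:~R * (monomial b y)%:~R) :> 'F_5.
Proof.
under eq_bigr => a _.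
  under eq_bigr => b _ do rewrite -!rmorphM /=.
  rewrite (sum_zsum 4 (fun b => exponent_pairing a b * (monomial a x * monomial b y))).
  over.
rewrite (sum_zsum 4 (fun a => zsum 4 (fun b =>
  exponent_pairing a b * (monomial a x * monomial b y)))).
have -> : (x + y == 0) = (5 %| x + y)%N.
  by rewrite (dvdn_pcharf (pchar_Fp (isT : prime 5))) natrD !natr_Zp.
have -> : (x == 0) = ((x : nat) == 0%N) by [].
apply/eqP; rewrite -[X in X == _](rmorph_nat (intmul 1)) F5_intr.
have tests : all (fun x => all (fun y => (5 %| ((x != 0%N) && (5 %| x + y)%N)%:R -
  zsum 4 (fun a => zsum 4 (fun b =>
  exponent_pairing a b * (monomial a x * monomial b y))))%Z) (iota 0 5)) (iota 0 5).
  by vm_compute.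
exact: (all_iota (all_iota tests x) y).
Qed.

Lemma pairing_so3 (x y : color_pair) :
  (pairing o0 x y)%:R - (pairing o1 x y)%:R - (pairing o2 x y)%:R =
  \sum_(a < 4) \sum_(b < 4) (exponent_pairing a b)%:~R *
    ((so3_matrix a x.1 x.2)%:~R * (so3_matrix b y.1 y.2)%:~R) :> 'F_5.
Proof.
case: x y => [i j] [k l]; rewrite /pairing /= -!val_eqE /=.
under eq_bigr => a _.
  under eq_bigr => b _ do rewrite -!rmorphM /=.
  rewrite (sum_zsum 4 (fun b => exponent_pairing a b * (so3_matrix a i j * so3_matrix b k l))).
  over.
rewrite (sum_zsum 4 (fun a => zsum 4 (fun b =>
  exponent_pairing a b * (so3_matrix a i j * so3_matrix b k l)))).
apply/eqP; rewrite -!(rmorph_nat (intmul (1 : 'F_5))) -!rmorphB F5_intr.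
have tests : all (fun i => all (fun j => all (fun k => all (fun l =>
  (5 %| (((i == k) && (j == l))%:R - ((i == l) && (j == k))%:R
         - ((i == j) && (k == l))%:R : int) -
  zsum 4 (fun a => zsum 4 (fun b =>
  exponent_pairing a b * (so3_matrix a i j * so3_matrix b k l))))%Z)
  (iota 0 3)) (iota 0 3)) (iota 0 3)) (iota 0 3).
  by vm_compute.
exact: (all_iota (all_iota (all_iota (all_iota tests i) j) k) l).
Qed.

(** Modulo 5 and up to order, so3_sum is supported on the exponents 000, 022
    and 013, which have weight zero; monomial_sum is supported on the same
    exponents and on 233, which has weight 2. *)
Lemma so3_monomial_sum (a b c : 'I_4) :
  (exponent_weight a + (exponent_weight b + exponent_weight c) < 0 ->
    (5 %| so3_sum a b c)%Z /\ (5 %| monomial_sum a b c)%Z) /\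
  (exponent_weight a + (exponent_weight b + exponent_weight c) = 0 ->
    (5 %| so3_sum a b c - 3 * monomial_sum a b c)%Z).
Proof.
have tests : all (fun a => all (fun b => all (fun c =>
    let w := exponent_weight a + (exponent_weight b + exponent_weight c) in
    let m := monomial_sum a b c in let s := so3_sum a b c in
    ((w < 0) ==> ((5 %| s)%Z && (5 %| m)%Z)) && ((w == 0) ==> (5 %| s - 3 * m)%Z))
  (iota 0 4)) (iota 0 4)) (iota 0 4) by vm_compute.
have /andP[/implyP neg /implyP zero] := all_iota (all_iota (all_iota tests a) b) c.
by split=> [/neg/andP | /eqP/zero].
Qed.

Section Comparison.

Variables (V E : finType) (phi : V * 'I_3 -> E * bool).
Hypothesis phi_bij : bijective phi.

Let epsilon2 (x y z : color_pair) : 'F_5 := (levi_civita2 x y z)%:~R.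

(** Replacing twice the identity pairing by the difference of the pairings on
    every edge does not change the contraction, as the two differ by the
    negligible sum of the pairings. *)
Lemma contraction_identity :
  2%:R ^+ #|E| * contraction phi (fun _ x y => (pairing o0 x y)%:R) epsilon2 =
  contraction phi (fun _ x y => (pairing o0 x y)%:R - (pairing o1 x y)%:R
    - (pairing o2 x y)%:R) epsilon2.
Proof.
have [psi phiK psiK] := phi_bij.
pose w (b : bool) (t : 'I_3) : 'F_5 := if b then 1 else if t == o0 then 1 else -1.
have -> : 2%:R ^+ #|E| * contraction phi (fun _ x y => (pairing o0 x y)%:R) epsilon2 =
    contraction phi (fun _ x y => \sum_b \sum_t w b t * (pairing t x y)%:R) epsilon2.
  rewrite (_ : 2%:R ^+ #|E| = \prod_(e : E) 2%:R); last by rewrite prodr_const.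
  rewrite -contraction_scale_edge.
  apply: eq_contraction => // _ x y; rewrite big_bool !big_I3 /w /=; ring.
rewrite contraction_sum (bigD1 [ffun=> false]) //= big1 ?addr0 => [|J J0].
  apply: eq_contraction => // e x y; rewrite ffunE big_I3 /w /=; ring.
have /existsP[e0 Je0] : [exists e, J e].
  apply: contraR J0; rewrite negb_exists => /forallP Je.
  by apply/eqP/ffunP => e; rewrite ffunE; apply/negbTE/Je.
apply: (negligible phi_bij phiK psiK (w := fun e => w (J e)) (e0 := e0)) => // t.
by rewrite Je0.
Qed.

Lemma contraction_monomial :
  contraction phi (fun _ (x y : 'F_5) => ((x != 0) && (x + y == 0))%:R)
    (fun x y z => (x + (y + z) == 0)%:R : 'F_5) =
  contraction phi (fun _ (a b : 'I_4) => (exponent_pairing a b)%:~R)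
    (fun a b c => (monomial_sum a b c)%:~R).
Proof.
apply: (contraction_basis phi_bij (X := fun (a : 'I_4) (x : 'F_5) => (monomial a x)%:~R)).
  by move=> _ x y; apply: monomial_pairing.
move=> a b c; symmetry.
transitivity (\sum_(x : 'F_5) \sum_(y : 'F_5) \sum_(z : 'F_5)
    ((5 %| x + y + z)%N%:R * (monomial a x * (monomial b y * monomial c z)))%:~R : 'F_5).
  apply: eq_bigr => x _; apply: eq_bigr => y _; apply: eq_bigr => z _.
  rewrite !rmorphM rmorph_nat; congr (_%:R * _).
  by rewrite (dvdn_pcharf (pchar_Fp (isT : prime 5))) !natrD !natr_Zp addrA.
pose summand x y z := (5 %| x + y + z)%N%:R * (monomial a x * (monomial b y * monomial c z)).
under eq_bigr => x _.
  under eq_bigr => y _ do rewrite (sum_zsum _ (summand x y)).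
  rewrite (sum_zsum _ (fun y => zsum _ (summand x y))); over.
by rewrite (sum_zsum _ (fun x => zsum _ (fun y => zsum _ (summand x y)))).
Qed.

Lemma contraction_so3 :
  contraction phi (fun _ x y => (pairing o0 x y)%:R - (pairing o1 x y)%:R
    - (pairing o2 x y)%:R) epsilon2 =
  contraction phi (fun _ (a b : 'I_4) => (exponent_pairing a b)%:~R)
    (fun a b c => (so3_sum a b c)%:~R).
Proof.
apply: (contraction_basis phi_bij (X := fun (a : 'I_4) (x : color_pair) =>
  (so3_matrix a x.1 x.2)%:~R)).
  by move=> _ x y; apply: pairing_so3.
move=> a b c; symmetry.
pose summand i0 j0 i1 j1 i2 j2 := levi_civita i0 i1 i2 * levi_civita j0 j1 j2 *
    (so3_matrix a i0 j0 * (so3_matrix b i1 j1 * so3_matrix c i2 j2)).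
transitivity (\sum_(x : color_pair) \sum_(y : color_pair) \sum_(z : color_pair)
    (summand x.1 x.2 y.1 y.2 z.1 z.2)%:~R : 'F_5).
  apply: eq_bigr => x _; apply: eq_bigr => y _; apply: eq_bigr => z _.
  by rewrite /summand /epsilon2 /levi_civita2 !rmorphM.
under eq_bigr => x _.
  under eq_bigr => y _ do rewrite (sum_zsum2 3 (summand x.1 x.2 y.1 y.2)).
  rewrite (sum_zsum2 3 (fun i j => zsum 3 (fun i' => zsum 3 (summand x.1 x.2 i j i')))).
  over.
by rewrite (sum_zsum2 3 (fun i j => zsum 3 (fun i' => zsum 3 (fun j' =>
  zsum 3 (fun i'' => zsum 3 (summand i j i' j' i'')))))).
Qed.

Lemma contraction_comparison :
  2%:R ^+ #|E| * contraction phi (fun _ x y => (pairing o0 x y)%:R) epsilon2 =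
  3%:R ^+ #|V| * contraction phi
    (fun _ (x y : 'F_5) => ((x != 0) && (x + y == 0))%:R)
    (fun x y z => (x + (y + z) == 0)%:R).
Proof.
rewrite contraction_identity contraction_so3 contraction_monomial.
rewrite -contraction_scale_vertex.
have zeroE (x : int) : (5 %| x)%Z -> x%:~R = 0 :> 'F_5.
  by move=> x5; apply/eqP; rewrite -[0](rmorph0 (intmul 1)) F5_intr subr0.
apply: (contraction_weight phi_bij (wt := fun a : 'I_4 => exponent_weight a)).
- move=> a b; have : all (fun a => all (fun b =>
     (exponent_weight a + exponent_weight b != 0) ==> (exponent_pairing a b == 0))
     (iota 0 4)) (iota 0 4) by vm_compute.
  by move=> /all_iota/(_ a)/all_iota/(_ b)/implyP ab /ab/eqP ->.
- move=> a b c /(so3_monomial_sum a b c).1[/zeroE -> /zeroE ->].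
  by rewrite mulr0.
move=> a b c /(so3_monomial_sum a b c).2 abc.
by apply/eqP; rewrite -[3%:R](rmorph_nat (intmul 1)) -rmorphM F5_intr.
Qed.

End Comparison.

(** * Flows and edge colourings as networks *)

Section Cubic.

Variables (G : graph) (S : ribbon G).
Variable phi : vertex G * 'I_3 -> half_edge G.
Hypothesis phiP : corner_labels S phi.

Let phi_bij : bijective phi. Proof. by case: phiP. Qed.

Lemma penrose_square :
  ((\sum_(c : {ffun edge G -> 'I_3}) \prod_v levi_civita (c (phi (v, o0)).1)
      (c (phi (v, o1)).1) (c (phi (v, o2)).1)) ^+ 2)%:~R =
  contraction phi (fun _ x y => (pairing o0 x y)%:R)
    (fun x y z => (levi_civita2 x y z)%:~R) :> 'F_5.
Proof.
rewrite expr2 big_distrlr /=.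
pose col (c : {ffun edge G -> 'I_3} * {ffun edge G -> 'I_3}) :
    {ffun half_edge G -> color_pair} := [ffun h => (c.1 h.1, c.2 h.1)].
pose uncol (c : {ffun half_edge G -> color_pair}) :
    {ffun edge G -> 'I_3} * {ffun edge G -> 'I_3} :=
  ([ffun e => (c (e, false)).1], [ffun e => (c (e, false)).2]).
pose const (c : {ffun half_edge G -> color_pair}) :=
  [forall e, pairing o0 (c (e, false)) (c (e, true))].
transitivity (\sum_(c : {ffun half_edge G -> color_pair} | const c)
  (\prod_v levi_civita2 (c (phi (v, o0))) (c (phi (v, o1))) (c (phi (v, o2))))%:~R : 'F_5).
  rewrite (reindex_onto col uncol) => [|c /forallP cc]; last first.
    apply/ffunP => -[e b]; rewrite !ffunE /=; have := cc e; rewrite /pairing /=.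
    by case: b; case: (c (e, true)) (c (e, false)) => [? ?] [? ?] //= /andP[/eqP-> /eqP->].
  rewrite pair_bigA rmorph_sum /=; apply: eq_big => [c | [c1 c2] _].
    apply/esym/andP; split.
      by apply/forallP => e; rewrite !ffunE /pairing /= !eqxx.
    case: c => c1 c2; apply/eqP; congr (_, _); apply/ffunP => e; by rewrite !ffunE.
  rewrite -big_split /=; congr (_%:~R); apply: eq_bigr => v _.
  by rewrite /levi_civita2 !ffunE.
rewrite big_mkcond /=; apply: eq_bigr => c _; rewrite rmorph_prod.
rewrite (prod_bool _ (fun e => pairing o0 (c (e, false)) (c (e, true)))) -/(const c).
by case: (const c); rewrite ?mul1r ?mul0r.
Qed.

Lemma sum_incidence (R : finFieldType) (x : edge G -> R) (v : vertex G) :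
  \sum_e x e * incidence R (fun e => endpoint e false) (fun e => endpoint e true) e v =
  \sum_(d : half_edge G | foot d == v) (if d.2 then x d.1 else - x d.1).
Proof.
rewrite [RHS]big_mkcond /= (eq_bigr (fun d : half_edge G =>
  if foot (d.1, d.2) == v then if d.2 then x d.1 else - x d.1 else 0)); last by case.
rewrite -(pair_bigA _ (fun e b => if foot (e, b) == v then if b then x e else - x e else 0)).
apply: eq_bigr => e _; rewrite big_bool /= /incidence /foot /= mulrBr.
by do 2![case: (_ == v)]; rewrite ?mulr1 ?mulr0 ?oppr0.
Qed.

(** The value at 0 is congruent to the value at 5, the number of nowhere-zero
    flows; the condition on the two halves of an edge is that their values are
    opposite. *)
Lemma flow_contraction :
  ((flow G).[0])%:~R = contraction phi
    (fun _ (x y : 'F_5) => ((x != 0) && (x + y == 0))%:R)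
    (fun x y z => (x + (y + z) == 0)%:R) :> 'F_5.
Proof.
have -> : ((flow G).[0])%:~R = ((flow G).[#|'F_5|%:R])%:~R :> 'F_5.
  rewrite -!(horner_map (intmul 1)) /= card_Fp //; congr (_.[_]).
  exact: val_inj.
pose t (e : edge G) := endpoint e false; pose h (e : edge G) := endpoint e true.
have endsE e : [set endpoint e b | b : bool] = [set t e; h e].
  apply/setP => v; rewrite !inE; apply/imsetP/orP => [[[] _ ->]|[]/eqP->].
  - by right.
  - by left.
  - by exists false.
  by exists true.
rewrite /flow (flow_polynomial_card 'F_5 endsE) rmorph_nat.
pose edge_ok (c : half_edge G -> 'F_5) :=
  [forall e, (c (e, false) != 0) && (c (e, false) + c (e, true) == 0)].
pose vertex_ok (c : half_edge G -> 'F_5) := [forall v, \sum_(d | foot d == v) c d == 0].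
transitivity (#|[set c : {ffun half_edge G -> 'F_5} | edge_ok c && vertex_ok c]|%:R : 'F_5).
  congr (_%:R); apply: (@card_bij_on _ _ _
    (fun c : {ffun half_edge G -> 'F_5} => edge_ok c && vertex_ok c)
    (fun x : {ffun edge G -> 'F_5} => [ffun d => if d.2 then x d.1 else - x d.1])
    (fun c : {ffun half_edge G -> 'F_5} => [ffun e => c (e, true)])).
    move=> x /andP[/forallP xf /forallP xnz]; split; last first.
      by apply/ffunP => e; rewrite !ffunE.
    apply/andP; split; apply/forallP => u; rewrite ?ffunE /=.
      by rewrite oppr_eq0 xnz addNr eqxx.
    apply/eqP; rewrite -[RHS](eqP (xf u)) sum_incidence.
    by apply: eq_bigr => d _; rewrite ffunE.
  move=> c /andP[/forallP ce /forallP cv].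
  have cE e : c (e, false) = - c (e, true).
    by have /andP[_] := ce e; rewrite addr_eq0 => /eqP.
  split; last by apply/ffunP => -[e []]; rewrite !ffunE //= cE.
  apply/andP; split; apply/forallP => u.
    apply/eqP; rewrite sum_incidence -[RHS](eqP (cv u)).
    by apply: eq_bigr => -[e []] _; rewrite ffunE //= cE.
  by have /andP[+ _] := ce u; rewrite ffunE cE oppr_eq0.
rewrite -sum1_card natr_sum big_mkcond /=; apply: eq_bigr => c _; rewrite inE.
have -> : \prod_e ((c (e, false) != 0) && (c (e, false) + c (e, true) == 0))%:R
    = (edge_ok c)%:R :> 'F_5.
  exact: prod_bool.
have -> : \prod_v (c (phi (v, o0)) + (c (phi (v, o1)) + c (phi (v, o2))) == 0)%:R
    = (vertex_ok c)%:R :> 'F_5.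
  rewrite prod_bool; congr (nat_of_bool _)%:R; apply: eq_forallb => v.
  by rewrite (sum_at_vertex phiP).
by case: (edge_ok c); rewrite ?mul0r ?mul1r //=; case: (vertex_ok c).
Qed.

End Cubic.

Theorem mainTheorem5 (G : graph) (cubicG : cubic G)
    (S : ribbon G) (D : diagram S) :
  ((flow G).[0] = 3 ^+ #|edge G| * yamada D (1 : int) ^+ 2 %[mod 5])%Z.
Proof.
have [phi phiP] := cubic_corner_labels S cubicG.
have phi_bij : bijective phi by case: phiP.
apply/eqP; rewrite eqz_mod_dvd -F5_intr rmorphM rmorphXn /=.
rewrite (yamada_penrose D phiP) penrose_square (flow_contraction phiP).
have := contraction_comparison phi_bij.
move: (contraction phi _ _) (contraction phi _ _) => N P PN.
have VE : (3 * #|vertex G| = 2 * #|edge G|)%N.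
  have := bij_eq_card phi_bij; rewrite !card_prod card_ord card_bool; lia.
have [k Vk Ek] : exists2 k, #|vertex G| = (2 * k)%N & #|edge G| = (3 * k)%N.
  by exists (#|edge G| - #|vertex G|)%N; lia.
apply/eqP; move: PN; rewrite Vk Ek !exprM.
(* Since 3 ^ 2 = -1, the identity 2 ^ (3k) P = 3 ^ (2k) N yields
   N = (- 3) ^ k P = 2 ^ k P, and 3 ^ (3k) = 2 ^ k. *)
have -> : 2%:R ^+ 3 = 3%:R :> 'F_5 by apply: val_inj.
have -> : 3%:R ^+ 2 = - 1 :> 'F_5 by apply: val_inj.
have -> : 3%:~R ^+ 3 = 2%:R :> 'F_5 by apply: val_inj.
have sgnK : (-1) ^+ k * (-1) ^+ k = 1 :> 'F_5 by rewrite -expr2 sqrr_sign.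
move=> PN; transitivity ((-1) ^+ k * (-1) ^+ k * N); first by rewrite sgnK mul1r.
rewrite -mulrA -PN mulrA -exprMn; congr (_ ^+ _ * _).
exact: val_inj.
Qed.
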